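(* Let $\overline{\mathbf P_{\mathrm{DIST}}}$ be the closure of $\mathbf P_{\mathrm{DIST}}$ in $\mathbb R^{\mathbb N}$ under pointwise convergence, and $\overline{\mathbf M_{\mathrm{DIST}}}$ the closure of $\mathbf M_{\mathrm{DIST}}$ in the L\'evy metric. Then $\overline{\mathbf M_{\mathrm{DIST}}}=\mathbf M_{\mathrm{DIST}}\sqcup\{\mathcal N(0,1)\}$, and the map $\Phi_{\mathrm{DIST}}:\overline{\mathbf P_{\mathrm{DIST}}}\to\overline{\mathbf M_{\mathrm{DIST}}}$ given by $\mathbf d\mapsto\mathcal S_{\mathbf d}$ for $\mathbf d\neq\mathbf 0$ and $\mathbf 0\mapsto\mathcal N(0,1)$ is a homeomorphism between (sequentially) compact spaces.
   Context: Finite multisets of nonnegative reals are identified with weakly decreasing sequences padded with zeros in $\mathbb R^{\mathbb N}$; $\mathbf 0$ is the all-zero sequence. For $\mathbf t=(t_1\ge t_2\ge\dots\ge0)$ with $|\mathbf t|_2=(\sum t_k^2)^{1/2}<\infty$, $\mathcal S_{\mathbf t}=\sum_k\mathcal U[-t_k/2,t_k/2]$ with independent summands, and for $\mathbf t\ne\mathbf0$, $\widehat{\mathbf t}=\sqrt{12}\,\mathbf t/|\mathbf t|_2$. The distance multiset of $\mathbf t=\{t_1\ge\cdots\ge t_m\}$ is $\Delta\mathbf t=\{t_i-t_j:1\le i<j\le m\}$. $\mathbf P_{\mathrm{DIST}}=\{\widehat{\Delta\mathbf t}:\mathbf t=\{1=t_1\ge\cdots\ge t_m=0\},m\ge2\}$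 and $\mathbf M_{\mathrm{DIST}}=\{\mathcal S_{\widehat{\Delta\mathbf t}}:\mathbf t=\{1=t_1\ge\cdots\ge t_m=0\},m\ge2\}$, the latter viewed as a set of distributions. The L\'evy metric metrizes convergence in distribution. *)

(* Defs.v *)
From HB Require Import structures.
From mathcomp Require Import all_boot all_order all_algebra finmap.
From mathcomp Require Import all_classical all_reals all_analysis.
From mathcomp Require Import lra.

Set Implicit Arguments.
Unset Strict Implicit.
Unset Printing Implicit Defensive.

Import Order.TTheory GRing.Theory Num.Theory.
Import numFieldNormedType.Exports.

Local Open Scope classical_set_scope.
Local Open Scope ring_scope.

(* The library's measures are total on [set R -> \bar R], with arbitrary values
   on non-Borel sets. A distribution is a Borel probability measure; fixing the
   value 0 off the Borel sets makes Leibniz equality of distributions agree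
   with equality on Borel sets (lemma [law_eqP]). *)
Record law (R : realType) := Law {
  law_prob :> probability (measurableTypeR R) R ;
  law_nmeas : forall A : set (measurableTypeR R), ~ measurable A ->
    law_prob A = 0%E }.

HB.instance Definition _ (R : realType) := gen_eqMixin (law R).
HB.instance Definition _ (R : realType) := gen_choiceMixin (law R).

Section law_of.
Context (R : realType) (P : probability (measurableTypeR R) R).
Local Open Scope ereal_scope.

Definition borel_restr (A : set (measurableTypeR R)) : \bar R :=
  if `[< measurable A >] then P A else 0.

Lemma borel_restrE A : measurable A -> borel_restr A = P A.
Proof. by rewrite /borel_restr => /asboolT ->. Qed.

Let borel_restr0 : borel_restr set0 = 0.
Proof. by rewrite borel_restrE. Qed.

Let borel_restr_ge0 A : 0 <= borel_restr A.
Proof. by rewrite /borel_restr; case: ifP. Qed.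

Let borel_restr_sigma_additive : semi_sigma_additive borel_restr.
Proof.
move=> F mF tF mUF; rewrite borel_restrE//.
under eq_fun do under eq_bigr do rewrite borel_restrE//.
exact: measure_semi_sigma_additive.
Qed.

HB.instance Definition _ := isMeasure.Build _ _ _ borel_restr
  borel_restr0 borel_restr_ge0 borel_restr_sigma_additive.

Let borel_restr_setT : borel_restr setT = 1.
Proof. by rewrite borel_restrE// probability_setT. Qed.

HB.instance Definition _ :=
  Measure_isProbability.Build _ _ R borel_restr borel_restr_setT.

Let borel_restr_nmeas (A : set (measurableTypeR R)) :
  ~ measurable A -> borel_restr A = 0.
Proof. by rewrite /borel_restr => /asboolF ->. Qed.

Definition law_of : law R := Law borel_restr_nmeas.

Lemma law_ofE A : measurable A -> law_of A = P A.
Proof. exact: borel_restrE. Qed.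

End law_of.

Section law_theory.
Context (R : realType).
Implicit Types (mu nu : law R) (x : R).

Lemma eq_probability_fun d (T : measurableType d) (P Q : probability T R) :
  P = Q :> (set T -> \bar R) -> P = Q.
Proof.
case: P Q => [P [[p1 q1] [p2] [p3] [p4] [p5] [p6] [p7]]].
move=> [Q [[p1' q1'] [p2'] [p3'] [p4'] [p5'] [p6'] [p7']]] /= PQ; subst Q.
rewrite (Prop_irrelevance p1' p1) (Prop_irrelevance q1' q1).
rewrite (Prop_irrelevance p2' p2) (Prop_irrelevance p3' p3).
rewrite (Prop_irrelevance p4' p4) (Prop_irrelevance p5' p5).
by rewrite (Prop_irrelevance p6' p6) (Prop_irrelevance p7' p7).
Qed.

Lemma law_eqP mu nu :
  mu = nu <-> forall A : set (measurableTypeR R), measurable A -> mu A = nu A.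
Proof.
split=> [->//|]; case: mu nu => [P P0] [Q Q0] /= PQ.
have {}PQ : P = Q.
  apply: eq_probability_fun; apply/funext => A.
  by have [/PQ//|nA] := pselect (measurable A); rewrite P0 ?Q0.
by subst Q; congr Law; exact: Prop_irrelevance.
Qed.

Definition law_cdf mu x : R := fine (mu `]-oo, x]%classic).

Lemma law_cdf_ge0 mu x : 0 <= law_cdf mu x.
Proof. by rewrite fine_ge0. Qed.

Lemma law_cdf_le1 mu x : law_cdf mu x <= 1.
Proof.
by rewrite -lee_fin fineK ?fin_num_measure//; exact: probability_le1.
Qed.

Lemma law_cdf_homo mu : {homo law_cdf mu : x y / x <= y}.
Proof.
move=> x y xy; rewrite fine_le ?fin_num_measure//.
by rewrite le_measure ?inE//; exact: subitvPr.
Qed.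

Lemma law_cdf_rcont mu : right_continuous (law_cdf mu).
Proof.
move=> x; apply: fine_cvg; rewrite fineK ?fin_num_measure//.
pose idR : measurableTypeR R -> R := idfun.
have midR : measurable_fun setT idR by exact: measurable_id.
pose X : {RV (mu : probability _ R) >-> R} :=
  HB.pack idR (isMeasurableFun.Build _ _ _ _ idR midR).
exact: (@cdf_right_continuous _ _ _ _ X x).
Qed.

Lemma law_cdf_inj mu nu : law_cdf mu = law_cdf nu -> mu = nu.
Proof.
move=> mn; apply/law_eqP => A mA.
have E x : mu `]-oo, x]%classic = nu `]-oo, x]%classic.
  by rewrite -[LHS]fineK ?fin_num_measure// -[RHS]fineK ?fin_num_measure//
    -/(law_cdf mu x) mn.
apply: (@measure_unique _ R (measurableTypeR R)
  [set A | exists x : R, A = `]x, +oo[%classic]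
  (fun n => `](- n%:R : R), +oo[%classic)) => //.
- exact: measurable_realfun.RGenOInfty.measurableE.
- move=> _ _ [x ->] [y ->]; exists (Num.max x y); apply/seteqP; split => z /=;
    rewrite !in_itv/= !andbT gt_max; first by case=> -> ->.
  by move=> /andP[].
- by move=> n; exists (- n%:R).
- apply/seteqP; split => // x _; exists (Num.bound `|x|) => //=.
  by rewrite in_itv/= andbT ltrNl (le_lt_trans (ler_norm _))// normrN archi_boundP.
- move=> _ [x ->]; have -> : `]x, +oo[%classic = ~` `]-oo, x]%classic.
    by rewrite setCitvl.
  have mC (m : law R) : m (~` `]-oo, x]%classic) = (1 - m `]-oo, x]%classic)%E.
    exact: probability_setC.
  by apply: (etrans (mC mu)); rewrite E; exact/esym/mC.
- by move=> n; rewrite (le_lt_trans (probability_le1 mu _))// ltry.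
Qed.

Definition levy_set mu nu : set R :=
  [set e | 0 < e /\ forall x, law_cdf mu (x - e) - e <= law_cdf nu x
                              <= law_cdf mu (x + e) + e].

Definition levy_dist mu nu : R := inf (levy_set mu nu).

Lemma levy_set_has_inf mu nu : has_inf (levy_set mu nu).
Proof.
split; last by exists 0 => e [/ltW].
exists 1; split => // x; apply/andP; split.
  by rewrite (@le_trans _ _ 0) ?law_cdf_ge0// subr_le0 law_cdf_le1.
by rewrite (@le_trans _ _ 1) ?law_cdf_le1// lerDr law_cdf_ge0.
Qed.

Lemma levy_dist_ge0 mu nu : 0 <= levy_dist mu nu.
Proof.
by apply: lb_le_inf; [case: (levy_set_has_inf mu nu)|move=> e [/ltW]].
Qed.

Lemma levy_distP mu nu e : levy_dist mu nu < e ->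
  exists2 e', levy_set mu nu e' & e' < e.
Proof. by move=> /inf_lt -/(_ (levy_set_has_inf mu nu).1)[e' ? ?]; exists e'. Qed.

Lemma levy_dist_le mu nu e : levy_set mu nu e -> levy_dist mu nu <= e.
Proof. by apply: ge_inf; case: (levy_set_has_inf mu nu). Qed.

Lemma levy_distxx mu : levy_dist mu mu = 0.
Proof.
apply/eqP; rewrite eq_le levy_dist_ge0 andbT.
apply/ler_addgt0Pl => e e0; rewrite addr0; apply: levy_dist_le; split=> // x.
apply/andP; split.
  by rewrite lerBlDr; apply: ler_wpDr; [exact: ltW|
    apply: law_cdf_homo; rewrite gerBl ltW].
by apply: ler_wpDr; [exact: ltW|apply: law_cdf_homo; rewrite lerDl ltW].
Qed.

Lemma levy_set_sym mu nu e : levy_set mu nu e -> levy_set nu mu e.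
Proof.
move=> [e0 H]; split => // x; apply/andP; split.
  by have /andP[_] := H (x - e); rewrite subrK lerBlDr.
by have /andP[+ _] := H (x + e); rewrite addrK lerBlDr.
Qed.

Lemma levy_dist_sym mu nu : levy_dist mu nu = levy_dist nu mu.
Proof. by congr inf; apply/seteqP; split => e; exact: levy_set_sym. Qed.

Lemma levy_dist_triangle nu mu xi :
  levy_dist mu xi <= levy_dist mu nu + levy_dist nu xi.
Proof.
apply/ler_addgt0Pl => e e0.
have [a [a0 Ha] ae] : exists2 a, levy_set mu nu a & a < levy_dist mu nu + e / 2.
  by apply: levy_distP; rewrite ltrDl divr_gt0.
have [b [b0 Hb] be] : exists2 b, levy_set nu xi b & b < levy_dist nu xi + e / 2.
  by apply: levy_distP; rewrite ltrDl divr_gt0.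
apply: (@le_trans _ _ (a + b)); last first.
  by rewrite (le_trans (lerD (ltW ae) (ltW be)))// addrACA -splitr addrC.
apply: levy_dist_le; split; first exact: addr_gt0.
move=> x; have /andP[b1 b2] := Hb x.
have /andP[a1 _] := Ha (x - b); have /andP[_ a2] := Ha (x + b).
rewrite (_ : x - (a + b) = x - b - a); last by rewrite opprD addrA addrAC.
rewrite (_ : x + (a + b) = x + b + a); last by rewrite addrA addrAC.
by apply/andP; split; lra.
Qed.

Lemma levy_dist_positivity mu nu : levy_dist mu nu = 0 -> mu = nu.
Proof.
suff le m n x : levy_dist m n = 0 -> law_cdf n x <= law_cdf m x.
  move=> d0; apply: law_cdf_inj; apply/funext => x; apply/eqP.
  by rewrite eq_le !le// levy_dist_sym.
move=> levy0; apply/ler_addgt0Pl => e e0.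
have e20 : 0 < e / 2 by rewrite divr_gt0.
have /cvgrPdist_lt/(_ _ e20)[d /= d0 Hd] := @law_cdf_rcont m x.
have [a [a0 Ha]] : exists2 a, levy_set m n a & a < Num.min d (e / 2).
  by apply: levy_distP; rewrite levy0 lt_min d0.
rewrite lt_min => /andP[ad ae].
have /andP[_ /le_trans] := Ha x; apply.
have := Hd (x + a); rewrite /ball_/= opprD addNKr normrN gtr0_norm//.
rewrite ltrDl => /(_ ad a0); rewrite distrC => /(le_lt_trans (ler_norm _)).
rewrite ltrBlDr => /ltW H.
by rewrite (le_trans (lerD H (ltW ae)))// addrAC -splitr.
Qed.

HB.instance Definition _ := isMetric.Build R (law R)
  levy_distxx levy_dist_positivity levy_dist_sym levy_dist_triangle.

End law_theory.

Definition mutually_independent d (T : measurableType d) (R : realType)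
    (P : probability T R) (X : nat -> {RV P >-> R}) :=
  forall (J : {fset nat}) (A : nat -> set R), (forall k, measurable (A k)) ->
    P (\bigcap_(k in [set` J]) X k @^-1` A k) =
    (\prod_(k <- J) P (X k @^-1` A k))%E.

(* U[-t/2, t/2], for t >= 0; it is the Dirac mass at 0 when t = 0. *)
Definition centered_uniform (R : realType) (t : R) :
    probability (measurableTypeR R) R :=
  match pselect (- (t / 2) < t / 2) with
  | left ab => uniform_prob ab
  | right _ => @dirac _ (measurableTypeR R) 0 R
  end.

Section uniform_sums.
Context (R : realType).
Implicit Types (t : nat -> R) (mu : law R).

(* For a square-summable t, independent X k ~ U[-t_k/2, t_k/2] have an almost
   surely convergent sum. *)
Definition is_uniform_sum_law t mu :=
  exists (d : measure_display) (T : measurableType d) (P : probability T R)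
    (X : nat -> {RV P >-> R}) (S : {RV P >-> R}),
  [/\ mutually_independent X,
      forall k (A : set R), measurable A ->
        distribution P (X k) A = centered_uniform (t k) A,
      {ae P, forall w, \sum_(0 <= k < n) X k w @[n --> \oo] --> S w} &
      forall A : set R, measurable A -> distribution P S A = mu A].

(* The distribution of S_t; the default value \d_0 is only there to make it a
   total function. *)
Definition uniform_sum_law t : law R :=
  xget (law_of (@dirac _ (measurableTypeR R) 0 R)) [set mu | is_uniform_sum_law t mu].

Definition std_normal : law R := law_of (normal_prob 0 1).

End uniform_sums.

Section distance_multisets.
Context (R : realType).
Implicit Types (s t : seq R) (u : nat -> R).

(* A finite multiset of nonnegative reals, listed in any order, as a weakly
   decreasing sequence padded with zeros. *)
Definition multiset_seq s : nat -> R := nth 0 (sort >=%R s).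

Definition l2norm u : R := Num.sqrt (limn (series (fun k => u k ^+ 2))).

Definition hat u : nat -> R := fun k => Num.sqrt 12 * u k / l2norm u.

Definition distance_multiset t : nat -> R :=
  multiset_seq [seq t`_i - t`_j | j <- iota 0 (size t), i <- iota 0 j].

Definition unit_span_multiset t :=
  [/\ (2 <= size t)%N, sorted >=%R t, t`_0 = 1 & t`_(size t).-1 = 0].

Definition P_DIST : set {ptws nat -> R} :=
  [set hat (distance_multiset t) | t in unit_span_multiset].

Definition M_DIST : set (law R) :=
  [set uniform_sum_law (hat (distance_multiset t)) | t in unit_span_multiset].

Definition Phi_DIST (u : {ptws nat -> R}) : law R :=
  if `[< u = (fun=> 0) >] then std_normal R else uniform_sum_law u.

End distance_multisets.
Arguments P_DIST R : clear implicits.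
Arguments M_DIST R : clear implicits.

Definition homeomorphism_on (X Y : topologicalType) (A : set X) (B : set Y)
    (f : X -> Y) :=
  [/\ set_bij A B f,
      {within A, continuous f} &
      exists2 g : Y -> X,
        (forall x, A x -> g (f x) = x) & {within B, continuous g}].

Definition seq_compact (X : topologicalType) (A : set X) :=
  forall u : nat -> X, (forall n, A (u n)) ->
  exists2 phi : nat -> nat, {homo phi : m n / (m < n)%N} &
  exists2 l, A l & u \o phi @ \oo --> l.

(* Main.v *)
Require Import Defs.
From HB Require Import structures.
From mathcomp Require Import all_boot all_order all_algebra finmap.
From mathcomp Require Import all_classical all_reals all_analysis.
From mathcomp Require Import measurable_realfun ring lra.

Set Implicit Arguments.
Unset Strict Implicit.
Unset Printing Implicit Defensive.

Import Order.TTheory GRing.Theory Num.Theory.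
Import numFieldNormedType.Exports.

Local Open Scope classical_set_scope.
Local Open Scope ring_scope.

(** Every normalised distance multiset has [\sum d_k^2 = 12], and the span [1]
    together with [m] points forces the unnormalised sum of squares to be at
    least [m / 4]: hence [d_1] bounded away from [0] bounds [m], and the
    pointwise closure of the normalised multisets only adds [0] and is compact.

    The map to laws is continuous at nonzero points because only finitely many
    coordinates matter there, and at [0] by Lindeberg's replacement argument:
    averaging operators [f |-> E f(x + X)] commute with each other and are
    contractions, so the uniform summands can be exchanged one at a time for
    normal ones of the same variance, at a cost controlled by [d_1] when the
    test function is a smooth (logistic) step; such steps control the Levy
    distance.

    It is injective because the Laplace transform of [S_d] is the product of
    the [sinh(l d_k / 2) / (l d_k / 2)], whose logarithm is affine in [l] and
    [ln l] up to [\sum ln (1 - exp(- l d_k))]. As the latter vanishes for large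
    [l], it is determined by the law, and it determines the [d_k] one by one,
    from the smallest on. The normal law is not attained at nonzero points, as
    its support is unbounded. A continuous injection from a compact space to a
    metric space is a homeomorphism onto its closed image. *)

Section averages.
Context (R : realType).
Local Notation mR := (measurableTypeR R).
Local Open Scope ereal_scope.
Implicit Types (mu nu : probability mR R) (f g : R -> \bar R).

Definition ge0_measurable f :=
  measurable_fun setT f /\ forall x, 0 <= f x.

Lemma ge0_measurable_EFin (f : R -> R) : measurable_fun setT f ->
  (forall x, 0 <= f x)%R -> ge0_measurable (EFin \o f).
Proof.
by move=> mf f0; split=> [|x]; [exact/measurable_EFinP|rewrite lee_fin].
Qed.

Lemma ge0_measurable_indic (A : set R) :
  measurable A -> ge0_measurable (EFin \o (\1_A : R -> R)).
Proof. by move=> mA; apply: ge0_measurable_EFin => //; exact: measurable_indic. Qed.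

Lemma ge0_measurable_normX n : ge0_measurable (fun x => (`|x| ^+ n)%:E).
Proof.
apply: ge0_measurable_EFin; last by move=> x; exact: exprn_ge0.
by apply: measurable_funX; exact: normr_measurable.
Qed.

Lemma ge0_measurable_comp f (h : R -> R) : measurable_fun setT h ->
  ge0_measurable f -> ge0_measurable (f \o h).
Proof. by move=> mh [mf f0]; split=> [|x]; [exact: measurableT_comp|exact: f0]. Qed.

Lemma ge0_measurable_shift f x :
  ge0_measurable f -> ge0_measurable (fun y => f (x + y)%R).
Proof. by apply: ge0_measurable_comp; exact: measurable_funD. Qed.

Lemma ge0_measurableDr f (c : R) : ge0_measurable f -> (0 <= c)%R ->
  ge0_measurable (fun x => f x + c%:E).
Proof.
move=> [mf f0] c0; split=> [|x]; first exact: emeasurable_funD.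
by rewrite adde_ge0// lee_fin.
Qed.

Lemma integral_indicT mu (A : set R) : measurable A ->
  \int[mu]_x (\1_A x)%:E = mu A.
Proof. by move=> mA; rewrite integral_indic// setIT. Qed.

Lemma ge0_integralDr_cst mu f (c : R) : ge0_measurable f -> (0 <= c)%R ->
  \int[mu]_x (f x + c%:E) = \int[mu]_x f x + c%:E.
Proof.
move=> [mf f0] c0.
by rewrite ge0_integralD// integral_cst//= probability_setT mule1.
Qed.

Definition average mu f (x : R) : \bar R := \int[mu]_y f (x + y)%R.

Definition averages (mus : seq (probability mR R)) f : R -> \bar R :=
  foldr average f mus.

Lemma ge0_measurable_average mu f :
  ge0_measurable f -> ge0_measurable (average mu f).
Proof.
move=> [mf f0]; split=> [|x]; last exact: integral_ge0.
apply: (@measurable_fun_fubini_tonelli_F _ _ mR mR R mu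
  (fun z : R * R => f (z.1 + z.2)%R)) => //.
by apply: measurableT_comp => //; exact: measurable_funD.
Qed.

Lemma averageC mu nu f : ge0_measurable f ->
  average mu (average nu f) = average nu (average mu f).
Proof.
move=> [mf f0]; apply/funext => x; rewrite /average.
have mfD : measurable_fun setT (fun z : R * R => f (x + z.1 + z.2)%R).
  apply: measurableT_comp => //; apply: measurable_funD => //.
  exact: measurable_funD.
under [RHS]eq_integral do under eq_integral do rewrite addrAC.
exact: (@fubini_tonelli _ _ _ _ _ mu nu _ mfD).
Qed.

Lemma le_average mu f g : ge0_measurable f -> ge0_measurable g ->
  (forall x, f x <= g x) -> forall x, average mu f x <= average mu g x.
Proof.
move=> gmf gmg fg x.
have [mf f0] := ge0_measurable_shift x gmf.
have [mg _] := ge0_measurable_shift x gmg.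
exact: ge0_le_integral.
Qed.

Lemma averageDr mu f (c : R) : ge0_measurable f -> (0 <= c)%R ->
  average mu (fun x => f x + c%:E) = (fun x => average mu f x + c%:E).
Proof.
move=> gmf c0; apply/funext => x.
by rewrite /average ge0_integralDr_cst//; exact: ge0_measurable_shift.
Qed.

Lemma ge0_measurable_averages mus f :
  ge0_measurable f -> ge0_measurable (averages mus f).
Proof. by move=> gmf; elim: mus => //= mu mus; exact: ge0_measurable_average. Qed.

Lemma averages_averageC mus mu f : ge0_measurable f ->
  averages mus (average mu f) = average mu (averages mus f).
Proof.
move=> gmf; elim: mus => //= nu mus ->.
by rewrite averageC//; exact: ge0_measurable_averages.
Qed.

Lemma le_averages mus f g : ge0_measurable f -> ge0_measurable g ->
  (forall x, f x <= g x) -> forall x, averages mus f x <= averages mus g x.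
Proof.
move=> gmf gmg fg; elim: mus => //= mu mus IH.
by apply: le_average => //; exact: ge0_measurable_averages.
Qed.

Lemma averagesDr mus f (c : R) : ge0_measurable f -> (0 <= c)%R ->
  averages mus (fun x => f x + c%:E) = (fun x => averages mus f x + c%:E).
Proof.
move=> gmf c0; elim: mus => //= mu mus ->.
by rewrite averageDr//; exact: ge0_measurable_averages.
Qed.

(* The averaging operators commute and are contractions for the sup distance,
   so their products can be compared one factor at a time. *)
Lemma le_averages_sum (I : eqType) (s : seq I) (M N : I -> probability mR R)
    (c : I -> R) f : ge0_measurable f -> (forall i, i \in s -> (0 <= c i)%R) ->
  (forall i x, i \in s -> average (M i) f x <= average (N i) f x + (c i)%:E) ->
  forall x, averages (map M s) f x <=
            averages (map N s) f x + (\sum_(i <- s) c i)%:E.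
Proof.
move=> gmf; elim: s => [|i s IH] c0 MN x /=; first by rewrite big_nil adde0.
have tail j : j \in s -> j \in i :: s by rewrite in_cons => ->; rewrite orbT.
have ci0 : (0 <= c i)%R by apply: c0; exact: mem_head.
have sum0 : (0 <= \sum_(i <- s) c i)%R.
  by rewrite big_seq; apply: sumr_ge0 => j /tail/c0.
have gmM mu := ge0_measurable_average mu gmf.
have gmMs K := ge0_measurable_averages (map K s) gmf.
have replace_tail : average (M i) (averages (map M s) f) x <=
    average (M i) (averages (map N s) f) x + (\sum_(j <- s) c j)%:E.
  have := le_average (M i) (gmMs M) (ge0_measurableDr (gmMs N) sum0).
  by rewrite averageDr//; apply; apply: IH => [j /tail/c0|j y /tail/MN].
have replace_head : average (M i) (averages (map N s) f) x <=
    average (N i) (averages (map N s) f) x + (c i)%:E.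
  rewrite -!averages_averageC//.
  have := le_averages (map N s) (gmM (M i)) (ge0_measurableDr (gmM (N i)) ci0).
  by rewrite averagesDr//; apply => y; apply: MN; exact: mem_head.
rewrite big_cons EFinD addeA; apply: (le_trans replace_tail).
exact: leeD2r.
Qed.

End averages.

Section vanishing_sequences.
Context (R : realType).
Implicit Types (u : nat -> R) (n : nat).

Definition vanishes_from n u := forall k, (n <= k)%N -> u k = 0.

Lemma sum_vanishes_from n m u : vanishes_from n u -> (n <= m)%N ->
  \sum_(0 <= k < m) u k = \sum_(0 <= k < n) u k.
Proof.
move=> u0 nm; rewrite (big_cat_nat (n := n))//= [X in _ + X]big_nat_cond.
by rewrite [X in _ + X]big1 ?addr0// => k /andP[/andP[/u0]].
Qed.

Lemma cvg_sum_vanishes_from n u : vanishes_from n u ->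
  \sum_(0 <= k < m) u k @[m --> \oo] --> \sum_(0 <= k < n) u k.
Proof.
by move=> u0; apply: cvg_near_cst; exists n => // m /=; exact: sum_vanishes_from.
Qed.

End vanishing_sequences.

Definition RV_of d d' (T : measurableType d) (T' : measurableType d')
    (R : realType) (P : probability T R) (f : T -> T')
    (mf : measurable_fun setT f) : {RV P >-> T'} :=
  HB.pack f (isMeasurableFun.Build _ _ T T' f mf).

Section independent_pairs.
Context d (T : measurableType d) (R : realType) (P : probability T R).
Context d1 (T1 : measurableType d1) d2 (T2 : measurableType d2).
Local Open Scope ereal_scope.
Implicit Types (Y : {RV P >-> T1}) (Z : {RV P >-> T2}).

Lemma indep_pair_prob Y Z (E : set T) : measurable E ->
  (forall A B, measurable A -> measurable B ->
     P (Y @^-1` A `&` (Z @^-1` B `&` E)) = P (Y @^-1` A) * P (Z @^-1` B) * P E) ->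
  forall D, measurable D ->
    P ((fun w => (Y w, Z w)) @^-1` D `&` E) =
    (distribution P Y \x distribution P Z) D * P E.
Proof.
move=> mE indep D mD.
pose YZ := RV_of P (measurable_fun_pair
  (@measurable_funPT _ _ _ _ Y) (@measurable_funPT _ _ _ _ Z)).
have [PE0|PE0] := eqVneq (P E) 0.
  rewrite PE0 mule0; apply/eqP; rewrite -measure_le0 -PE0.
  by apply: le_measure; rewrite ?inE//; apply: measurableI => //;
    exact: (measurable_funPTI YZ).
have PE_fin : P E \is a fin_num by exact: fin_num_measure.
have PEV_ge0 : (0 <= (fine (P E))^-1)%R by rewrite invr_ge0 fine_ge0.
have PEV : ((fine (P E))^-1)%:E * P E = 1.
  by rewrite -{2}(fineK PE_fin) -EFinM mulVf// fine_eq0.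
have [cond condE] : exists cond : {measure set (T1 * T2)%type -> \bar R},
    forall A, cond A = ((fine (P E))^-1)%:E * P (YZ @^-1` A `&` E).
  by unshelve eexists (mscale (NngNum PEV_ge0) (pushforward (mrestr P mE) YZ)).
rewrite (product_measure_unique (m' := cond))// => [|A B mA mB].
  by rewrite condE muleAC PEV mul1e.
rewrite condE (_ : YZ @^-1` _ `&` E = Y @^-1` A `&` (Z @^-1` B `&` E)).
  by rewrite indep// muleC -muleA [P E * _]muleC PEV mule1.
by apply/seteqP; split => w /= => [[[]]|[? []]].
Qed.

Lemma indep_pair_integral Y Z (f : T1 * T2 -> \bar R) :
  (forall A B, measurable A -> measurable B ->
     P (Y @^-1` A `&` Z @^-1` B) = P (Y @^-1` A) * P (Z @^-1` B)) ->
  measurable_fun setT f -> (forall z, 0 <= f z) ->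
  \int[P]_w f (Y w, Z w) =
  \int[distribution P Y]_y \int[distribution P Z]_z f (y, z).
Proof.
move=> indep mf f0; rewrite -fubini_tonelli1//.
pose YZ := RV_of P (measurable_fun_pair
  (@measurable_funPT _ _ _ _ Y) (@measurable_funPT _ _ _ _ Z)).
transitivity (\int[distribution P YZ]_z f z).
  by rewrite ge0_integral_distribution.
apply: eq_measure_integral => D mD _.
have := @indep_pair_prob Y Z setT measurableT _ D mD.
rewrite setIT probability_setT mule1; apply => A B mA mB.
by rewrite setIT mule1 indep.
Qed.

End independent_pairs.

Section independent_sums.
Context (R : realType) d (T : measurableType d) (P : probability T R).
Context (X : nat -> {RV P >-> R}).
Local Notation mR := (measurableTypeR R).
Local Open Scope ereal_scope.

Definition cylinder (J : {fset nat}) (A : nat -> set R) : set T :=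
  \bigcap_(k in [set` J]) X k @^-1` A k.

Lemma measurable_cylinder J A :
  (forall k, measurable (A k)) -> measurable (cylinder J A).
Proof.
move=> mA; apply: fin_bigcap_measurable => [|k _]; first exact: finite_fset.
exact: measurable_funPTI.
Qed.

Lemma cylinder0 A : cylinder fset0 A = setT.
Proof. by apply/seteqP; split => // w _ k /=; rewrite inE. Qed.

Lemma cylinderU1 J A n B : n \notin J ->
  cylinder (n |` J)%fset (fun k => if k == n then B else A k) =
  X n @^-1` B `&` cylinder J A.
Proof.
move=> nJ; have neq_n k : k \in J -> (k == n) = false.
  by move=> kJ; apply: contraNF nJ => /eqP <-.
apply/seteqP; split => w => [wJ|[wn wJ] k /=].
- split; first by have := wJ n; rewrite /= !inE eqxx; exact.
  by move=> k /= kJ; have := wJ k; rewrite /= !inE kJ orbT neq_n//; exact.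
- rewrite !inE => /predU1P[->|kJ]; first by rewrite eqxx.
  by rewrite neq_n//; exact: wJ.
Qed.

Definition indep_of_tail n (Y : T -> R) := forall (J : {fset nat}) A B,
  (forall k, k \in J -> (n <= k)%N) -> (forall k, measurable (A k)) ->
  measurable B ->
  P (Y @^-1` B `&` cylinder J A) = P (Y @^-1` B) * P (cylinder J A).

Hypothesis indepX : mutually_independent X.

Lemma prob_cylinderU1 J A n B : n \notin J -> measurable B ->
    (forall k, measurable (A k)) ->
  P (X n @^-1` B `&` cylinder J A) = P (X n @^-1` B) * P (cylinder J A).
Proof.
move=> nJ mB mA; rewrite -cylinderU1// indepX; last by move=> k; case: ifP.
rewrite big_fsetU1//= eqxx indepX//; congr (_ * _).
by apply: eq_big_seq => k kJ; case: eqP nJ => // <-; rewrite kJ.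
Qed.

Lemma indep_of_tail_cst c : indep_of_tail 0 (cst c).
Proof.
move=> J A B _ mA mB; rewrite preimage_cst; case: ifPn => _.
  by rewrite setTI probability_setT mul1e.
by rewrite set0I measure0 mul0e.
Qed.

Lemma indep_of_tail_triple n Y J A B C : indep_of_tail n Y ->
  (forall k, k \in J -> (n < k)%N) -> (forall k, measurable (A k)) ->
  measurable B -> measurable C ->
  P (Y @^-1` B `&` (X n @^-1` C `&` cylinder J A)) =
  P (Y @^-1` B) * P (X n @^-1` C) * P (cylinder J A).
Proof.
move=> indepY nJ mA mB mC.
have nnJ : n \notin J by apply/negP => /nJ; rewrite ltnn.
rewrite -cylinderU1// indepY//; last by move=> k; case: ifP.
  by rewrite cylinderU1// prob_cylinderU1// muleA.
by move=> k; rewrite !inE => /predU1P[->//|/nJ/ltnW].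
Qed.

Lemma indep_of_tail_pair n Y B C : indep_of_tail n Y ->
  measurable B -> measurable C ->
  P (Y @^-1` B `&` X n @^-1` C) = P (Y @^-1` B) * P (X n @^-1` C).
Proof.
move=> indepY mB mC.
have := @indep_of_tail_triple n Y fset0 (fun=> setT) B C indepY.
by rewrite cylinder0 setIT probability_setT mule1; apply.
Qed.

(* [mR] and [R] have the same measurable sets but different displays. *)
Lemma indep_of_tailS n Y : measurable_fun setT Y -> indep_of_tail n Y ->
  indep_of_tail n.+1 (fun w => (Y w + X n w)%R).
Proof.
move=> mY indepY J A B nJ mA mB.
have mX : measurable_fun setT (X n) by [].
pose Y' := @RV_of _ _ _ mR _ P Y mY; pose X' := @RV_of _ _ _ mR _ P (X n) mX.
pose D : set (mR * mR) := [set z | B (z.1 + z.2)%R].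
have mD : measurable D.
  rewrite -[D]setTI.
  apply: (_ : measurable_fun setT (fun z : mR * mR => z.1 + z.2 : mR)%R) => //.
  exact: measurable_funD.
rewrite (_ : _ @^-1` B = (fun w => (Y' w, X' w)) @^-1` D)//.
rewrite (@indep_pair_prob _ _ _ P _ mR _ mR Y' X' _ (measurable_cylinder J mA))//.
- congr (_ * _).
  have := @indep_pair_prob _ _ _ P _ mR _ mR Y' X' setT measurableT _ D mD.
  rewrite setIT probability_setT mule1 => -> // B' C' mB' mC'.
  by rewrite setIT mule1; exact: indep_of_tail_pair.
- by move=> B' C' mB' mC'; exact: indep_of_tail_triple.
Qed.

Definition partial_sum n w : R := (\sum_(0 <= k < n) X k w)%R.

Lemma measurable_partial_sum n : measurable_fun setT (partial_sum n).
Proof. by apply: measurable_sum => k. Qed.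

Lemma partial_sumS n : partial_sum n.+1 = (fun w => (partial_sum n w + X n w)%R).
Proof. by apply/funext => w; rewrite /partial_sum big_nat_recr. Qed.

Lemma indep_of_tail_partial_sum n : indep_of_tail n (partial_sum n).
Proof.
elim: n => [|n IH].
  rewrite (_ : partial_sum 0 = cst 0%R); first exact: indep_of_tail_cst.
  by apply/funext => w; rewrite /partial_sum big_nil.
rewrite partial_sumS; apply: indep_of_tailS => //.
exact: measurable_partial_sum.
Qed.

Lemma integral_partial_sum (mus : nat -> probability mR R) n (f : R -> \bar R) :
  (forall k (A : set R), measurable A -> distribution P (X k) A = mus k A) ->
  ge0_measurable f ->
  \int[P]_w f (partial_sum n w) = averages [seq mus k | k <- iota 0 n] f 0%R.
Proof.
move=> Xmu; elim: n f => [|n IH] f gmf.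
  under eq_integral do rewrite /partial_sum big_nil.
  by rewrite integral_cst//= probability_setT mule1.
have mX : measurable_fun setT (X n) by [].
pose S' := @RV_of _ _ _ mR _ P (partial_sum n) (measurable_partial_sum n).
pose X' := @RV_of _ _ _ mR _ P (X n) mX.
have [mf f0] := gmf; have [mavg avg0] := ge0_measurable_average (mus n) gmf.
rewrite partial_sumS.
transitivity (\int[distribution P S']_y average (mus n) f y); last first.
  rewrite ge0_integral_distribution// IH//.
  by rewrite -addn1 iotaD map_cat/= add0n /averages foldr_cat.
rewrite (@indep_pair_integral _ _ _ P _ mR _ mR S' X'
  (fun z => f (z.1 + z.2)%R))//.
- by apply: eq_integral => y _; apply: eq_measure_integral => A mA _; exact: Xmu.
- move=> B C mB mC; apply: indep_of_tail_pair => //.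
  exact: indep_of_tail_partial_sum.
- by apply: measurableT_comp => //; exact: measurable_funD.
Qed.

End independent_sums.

Section independent_family_existence.
Context (R : realType).
Local Notation mR := (measurableTypeR R).
Local Open Scope ereal_scope.

Lemma mutually_independent_cst d (T : measurableType d) (P : probability T R)
    (X : nat -> {RV P >-> R}) (x : nat -> R) :
  (forall k, X k = cst (x k) :> (T -> R)) -> mutually_independent X.
Proof.
move=> Xx J A mA.
have [inA|/existsNP[k /not_implyP[kJ nA]]] :=
    pselect (forall k, k \in J -> A k (x k)).
- have XA k : k \in J -> X k @^-1` A k = setT.
    by move=> /inA Ak; rewrite Xx preimage_cst mem_set.
  rewrite (_ : \bigcap_(k in _) _ = setT).
    rewrite probability_setT big_seq big1// => k /XA ->.
    exact: probability_setT.
  by apply/seteqP; split => // w _ k kJ; rewrite XA.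
- have XA : X k @^-1` A k = set0 by rewrite Xx preimage_cst memNset.
  rewrite (_ : \bigcap_(k in _) _ = set0).
    by rewrite measure0 (big_fsetD1 k)//= XA measure0 mul0e.
  by apply/seteqP; split => // w /(_ k kJ); rewrite XA.
Qed.

Section replace_coordinate.
Context d (T : measurableType d) (P : probability T R).
Context (X : nat -> {RV P >-> R}) (n : nat) (mu : probability mR R).
Let Q : probability (T * mR)%type R := (P \x mu)%E.
Let Y k (z : T * mR) : R := if k == n then z.2 else X k z.1.

Let measurable_Y k : measurable_fun setT (Y k).
Proof.
rewrite /Y; case: eqP => _; last exact: measurableT_comp.
exact: measurable_snd.
Qed.

Definition replace_coordinate k : {RV Q >-> R} := RV_of Q (@measurable_Y k).

Lemma replace_coordinateE k z : k != n -> replace_coordinate k z = X k z.1.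
Proof. by move=> /negPf kn; rewrite /= /Y kn. Qed.

Lemma distribution_replaced (A : set R) : measurable A ->
  distribution Q (replace_coordinate n) A = mu A.
Proof.
move=> mA; rewrite /distribution /pushforward.
rewrite (_ : replace_coordinate n @^-1` A = setT `*` A); last first.
  by apply/seteqP; split => z /=; rewrite /Y eqxx => // -[].
rewrite /Q/= product_measure1E// -[RHS]mul1e; congr (_ * _).
exact: probability_setT.
Qed.

Lemma distribution_replace_coordinate k (A : set R) : k != n -> measurable A ->
  distribution Q (replace_coordinate k) A = distribution P (X k) A.
Proof.
move=> kn mA; rewrite /distribution /pushforward.
rewrite (_ : replace_coordinate k @^-1` A = X k @^-1` A `*` setT); last first.
  by apply/seteqP; split => z /=; rewrite /Y (negPf kn) => // -[].
rewrite /Q/= product_measure1E//; last exact: measurable_funPTI.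
by rewrite -[RHS]mule1; congr (_ * _); exact: probability_setT.
Qed.

Lemma cylinder_replace_coordinate (J : {fset nat}) (A : nat -> set R) :
  cylinder replace_coordinate J A =
  cylinder X (J `\ n)%fset A `*` (if n \in J then A n else setT).
Proof.
apply/seteqP; split => [z zJ|z [zJ zn] k /= kJ].
- split => [k /=|].
    by rewrite !inE => /andP[kn kJ]; have := zJ k kJ; rewrite /= /Y (negPf kn).
  by case: ifPn => // nJ; have := zJ n nJ; rewrite /= /Y eqxx.
- rewrite /Y; case: eqP => [kn|/eqP kn]; first by move: zn; rewrite -kn kJ.
  by apply: zJ; rewrite /= !inE kn.
Qed.

Lemma replace_coordinate_indep :
  mutually_independent X -> mutually_independent replace_coordinate.
Proof.
move=> indX J A mA; rewrite -/(cylinder replace_coordinate J A).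
set B : set mR := if n \in J then A n else setT.
have mB : measurable B by rewrite /B; case: ifP => // _; exact: mA.
have -> : Q (cylinder replace_coordinate J A) =
    (\prod_(k <- (J `\ n)%fset) P (X k @^-1` A k)) * mu B.
  rewrite cylinder_replace_coordinate /Q/= product_measure1E//.
    by congr (_ * _); exact: indX.
  exact: measurable_cylinder.
have -> : \prod_(k <- (J `\ n)%fset) P (X k @^-1` A k) =
          \prod_(k <- (J `\ n)%fset) Q (replace_coordinate k @^-1` A k).
  apply: eq_big_seq => k; rewrite !inE => /andP[kn _].
  exact/esym/distribution_replace_coordinate.
rewrite /B; case: ifPn => nJ.
  rewrite [RHS](big_fsetD1 n)//= muleC; congr (_ * _).
  exact/esym/distribution_replaced.
rewrite mem_fsetD1//.
by rewrite -[RHS]mule1; congr (_ * _); exact: probability_setT.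
Qed.

End replace_coordinate.

Lemma independent_family_exists n (mus : nat -> probability mR R) :
  exists (d : measure_display) (T : measurableType d) (P : probability T R)
    (X : nat -> {RV P >-> R}),
  [/\ mutually_independent X,
      forall k (A : set R), (k < n)%N -> measurable A ->
        distribution P (X k) A = mus k A &
      forall w, vanishes_from n (X^~ w)].
Proof.
elim: n => [|n [d [T [P [X [indX distX X0]]]]]].
  pose P : probability mR R := @dirac _ mR 0%R R.
  pose X (k : nat) : {RV P >-> R} := RV_of P (@measurable_cst _ _ mR R setT 0%R).
  exists _, mR, P, X; split => //.
  exact: (@mutually_independent_cst _ _ _ _ (fun=> 0%R)).
exists _, (T * mR)%type, (P \x mus n)%E, (replace_coordinate X n (mus n)); split.
- exact: replace_coordinate_indep.
- move=> k A; rewrite ltnS leq_eqVlt => /predU1P[->|kn] mA.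
    exact: distribution_replaced.
  by rewrite -distX// distribution_replace_coordinate// lt_eqF.
- move=> w k nk; rewrite replace_coordinateE ?gtn_eqF//; exact/X0/ltnW.
Qed.

End independent_family_existence.

Section uniform_sum_laws.
Context (R : realType).
Local Notation mR := (measurableTypeR R).
Local Open Scope ereal_scope.
Implicit Types (u : nat -> R) (mu nu : law R).

Lemma centered_uniform0 : centered_uniform (0 : R) = @dirac _ mR 0%R R.
Proof.
rewrite /centered_uniform; case: pselect => // h; exfalso; move: h.
by rewrite mul0r oppr0 ltxx.
Qed.

Lemma distribution_centered_uniform0 d (T : measurableType d)
    (P : probability T R) (X : {RV P >-> R}) :
  (forall A : set R, measurable A ->
     distribution P X A = centered_uniform (0 : R) A) ->
  {ae P, forall w, X w = 0%R}.
Proof.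
move=> distX; exists (X @^-1` (~` [set 0%R])); split.
- by apply: measurable_funPTI; exact: measurableC.
- apply: (etrans (distX (~` [set 0%R]) _)); first exact: measurableC.
  by rewrite centered_uniform0/= diracE memNset//= => /(_ erefl).
- by move=> w /= nXw Xw; exact: nXw.
Qed.

Lemma integral_uniform_sum_law u n mu (f : R -> \bar R) :
  vanishes_from n u -> is_uniform_sum_law u mu -> ge0_measurable f ->
  \int[mu]_x f x = averages [seq centered_uniform (u k) | k <- iota 0 n] f 0%R.
Proof.
move=> u0 [d [T [P [X [S [indX distX aeS distS]]]]]] gmf.
have [mf f0] := gmf.
have mS : measurable_fun setT S by [].
pose S' := @RV_of _ _ _ mR _ P S mS.
transitivity (\int[distribution P S']_x f x).
  by apply: eq_measure_integral => A mA _; exact/esym/distS.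
rewrite ge0_integral_distribution// -(integral_partial_sum indX)//.
have mpS := measurable_partial_sum X n.
apply: ge0_ae_eq_integral => //; try exact: measurableT_comp.
  by move=> w _; exact: f0.
have aeX : {ae P, forall w, vanishes_from n (X^~ w)}.
  apply/ae_foralln => k; have [nk|nk] := leqP n k; last exact/aeW.
  have Xk0 : {ae P, forall w, X k w = 0%R}.
    by apply: distribution_centered_uniform0 => A mA; rewrite distX// u0.
  by apply: filterS Xk0 => w.
apply: filterS2 aeX aeS => w Xw Sw _ /=; congr f.
by apply: (cvg_unique _ Sw); [exact: norm_hausdorff|exact: cvg_sum_vanishes_from].
Qed.

Lemma uniform_sum_law_uniq u n mu nu : vanishes_from n u ->
  is_uniform_sum_law u mu -> is_uniform_sum_law u nu -> mu = nu.
Proof.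
move=> u0 u_mu u_nu; apply/law_eqP => A mA.
have probE xi : is_uniform_sum_law u xi -> xi A =
    averages [seq centered_uniform (u k) | k <- iota 0 n] (EFin \o \1_A) 0%R.
  move=> u_xi; rewrite -(integral_uniform_sum_law u0 u_xi).
    by rewrite integral_indicT.
  exact: ge0_measurable_indic.
by rewrite (probE mu)// (probE nu).
Qed.

Lemma uniform_sum_law_exists u n : vanishes_from n u ->
  exists mu, is_uniform_sum_law u mu.
Proof.
move=> u0; have [d [T [P [X [indX distX X0]]]]] :=
  independent_family_exists n (fun k => centered_uniform (u k)).
have mS := measurable_partial_sum X n.
pose S' := @RV_of _ _ _ mR _ P (partial_sum X n) mS.
exists (law_of (distribution P S')), d, T, P, X, (RV_of P mS); split=> //.
- move=> k A mA; have [nk|kn] := leqP n k; last exact: distX.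
  rewrite u0// centered_uniform0/= diracE /distribution /pushforward.
  rewrite (_ : X k @^-1` A = cst 0%R @^-1` A); last first.
    by apply/seteqP; split => w /=; rewrite X0.
  by rewrite preimage_cst; case: ifPn; rewrite ?probability_setT ?measure0.
- by apply/aeW => w; exact: cvg_sum_vanishes_from.
- by move=> A mA; rewrite law_ofE.
Qed.

Lemma uniform_sum_lawP u n : vanishes_from n u ->
  is_uniform_sum_law u (uniform_sum_law u).
Proof.
move=> u0; have [mu u_mu] := uniform_sum_law_exists u0.
by rewrite /uniform_sum_law; case: xgetP => [nu -> //|/(_ mu)].
Qed.

Lemma integral_uniform_sum_law_averages u n (f : R -> \bar R) :
  vanishes_from n u -> ge0_measurable f ->
  \int[uniform_sum_law u]_x f x =
  averages [seq centered_uniform x | x <- mkseq u n] f 0%R.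
Proof.
move=> u0 gmf; rewrite -map_comp; apply: integral_uniform_sum_law => //.
exact: uniform_sum_lawP u0.
Qed.

End uniform_sum_laws.

Section taylor.
Context (R : realType).
Implicit Types (f df : R -> R) (g : nat -> R -> R) (x y K : R) (n : nat).

Lemma is_derive_continuous f df :
  (forall x, is_derive x 1 f (df x)) -> continuous f.
Proof.
move=> fdf x; apply/differentiable_continuous/derivable1_diffP.
by have [] := fdf x.
Qed.

(* Cauchy's mean value theorem for [f] and the monomial [y ^+ n.+1]. *)
Lemma norm_le_of_derive f df K n : (forall y, is_derive y 1 f (df y)) ->
  f 0 = 0 -> (forall y, `|df y| <= K * (`|y| ^+ n / n`!%:R)) ->
  forall y, `|f y| <= K * (`|y| ^+ n.+1 / n.+1`!%:R).
Proof.
move=> fdf f0 dfK y.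
pose pow (z : R) : R := z ^+ n.+1; pose dpow (z : R) : R := n.+1%:R * z ^+ n.
have powD (z : R) : is_derive z 1 pow (dpow z).
  have := is_derive_poly 'X^(n.+1) z.
  rewrite derivXn /= hornerMn hornerXn -mulr_natl (_ : horner _ = pow)//.
  by apply/funext => t; rewrite hornerXn.
have within_continuous (h dh : R -> R) a b :
    (forall z : R, is_derive z 1 h (dh z)) -> {within `[a, b], continuous h}.
  move=> hdh; apply: continuous_subspaceT.
  exact: (@is_derive_continuous h dh).
have dpow_neq0 c : c != 0 -> dpow c != 0.
  by move=> c0; rewrite mulf_neq0 ?expf_neq0// pnatr_eq0.
have pow0 : pow 0 = 0 by rewrite /pow expr0n.
have [->|y0] := eqVneq y 0; first by rewrite f0 !normr0 expr0n mul0r mulr0.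
have [c c0 fyE] : exists2 c, c != 0 & df c / dpow c = f y / pow y.
  have [y_gt0|y_lt0] : 0 < y \/ y < 0 by apply/orP; rewrite -neq_lt eq_sym.
  - have [c|c] := cauchy_MVT y_gt0 (within_continuous _ _ _ _ fdf)
      (within_continuous _ _ _ _ powD) (fun z _ => fdf z) (fun z _ => powD z).
    + by rewrite in_itv/= => /andP[c0 _]; exact/dpow_neq0/lt0r_neq0.
    + by rewrite f0 pow0 !subr0 in_itv/= => /andP[/lt0r_neq0 c0 _]; exists c.
  - have [c|c] := cauchy_MVT y_lt0 (within_continuous _ _ _ _ fdf)
      (within_continuous _ _ _ _ powD) (fun z _ => fdf z) (fun z _ => powD z).
    + by rewrite in_itv/= => /andP[_ c0]; exact/dpow_neq0/ltr0_neq0.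
    + rewrite f0 pow0 !sub0r invrN mulrNN in_itv/= => /andP[_ /ltr0_neq0 c0].
      by exists c.
have -> : `|f y| = `|df c| / `|dpow c| * `|y ^+ n.+1|.
  by rewrite -normfV -!normrM fyE divfK// expf_neq0.
rewrite normrX [leRHS]mulrA [leRHS]mulrAC ler_pM2r ?exprn_gt0 ?normr_gt0//.
rewrite ler_pdivrMr ?normr_gt0 ?dpow_neq0// (le_trans (dfK c))//.
rewrite le_eqVlt normrM normrX normr_nat factS natrM; apply/orP; left.
by apply/eqP; field; rewrite nat1r !pnatr_eq0 -lt0n fact_gt0.
Qed.

Definition taylor_poly g n x : {poly R} := \poly_(k < n) (g k x / k`!%:R).

Lemma deriv_taylor_poly g n x :
  (taylor_poly g n.+1 x)^`() = taylor_poly (fun k => g k.+1) n x.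
Proof.
apply/polyP => k; rewrite coef_deriv !coef_poly ltnS; case: ifP => _.
  rewrite factS natrM -mulr_natr; field.
  by rewrite nat1r !pnatr_eq0 -lt0n fact_gt0.
by rewrite mul0rn.
Qed.

Lemma taylor_poly0 g n x : (taylor_poly g n.+1 x).[0] = g 0%N x.
Proof. by rewrite horner_coef0 coef_poly fact0 divr1. Qed.

Lemma taylor_le g n K :
  (forall k x, (k < n)%N -> is_derive x 1 (g k) (g k.+1 x)) ->
  (forall x, `|g n x| <= K) ->
  forall x y, `|g 0%N (x + y) - (taylor_poly g n x).[y]|
              <= K * (`|y| ^+ n / n`!%:R).
Proof.
elim: n g => [|n IH] g gD gK x y.
  rewrite (_ : taylor_poly g 0 x = 0); last first.
    by apply/polyP => i; rewrite coef_poly coef0.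
  by rewrite horner0 subr0 expr0 fact0 divr1 mulr1.
have /= := @norm_le_of_derive (fun z => g 0%N (x + z) - (taylor_poly g n.+1 x).[z])
  (fun z => g 1%N (x + z) - (taylor_poly (fun k => g k.+1) n x).[z]) K n.
apply=> [z||z].
- have shiftD : is_derive z 1 (fun z : R => x + z) (0 + 1) by exact: is_deriveD.
  have := is_derive1_comp (gD 0%N (x + z) isT) shiftD; rewrite add0r mulr1 => g0D.
  by rewrite -deriv_taylor_poly; exact: is_deriveB.
- by rewrite addr0 taylor_poly0 subrr.
- by apply: (IH (fun k => g k.+1)) => // k x' kn; exact: gD.
Qed.

End taylor.

Section logistic.
Context (R : realType).
Implicit Types (x y a h : R).

Definition logistic x : R := (1 + expR x)^-1.

Lemma logistic_gt0 x : 0 < logistic x.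
Proof. by rewrite invr_gt0 addr_gt0// expR_gt0. Qed.

Lemma logistic_lt1 x : logistic x < 1.
Proof. by rewrite invf_lt1 ?ltrDl ?expR_gt0// addr_gt0// expR_gt0. Qed.

Lemma logisticN x : logistic (- x) = 1 - logistic x.
Proof.
rewrite /logistic expRN; have := expR_gt0 x => x0.
by field; rewrite !gt_eqF// addr_gt0.
Qed.

Lemma logistic_le_expRN x : logistic x <= expR (- x).
Proof.
by rewrite expRN /logistic lef_pV2 ?posrE ?expR_gt0 ?addr_gt0 ?expR_gt0// lerDr.
Qed.

Lemma is_derive_logistic x :
  is_derive x 1 logistic ('X^2 - 'X).[logistic x].
Proof.
have x0 := expR_gt0 x; have x1 : 1 + expR x != 0 by rewrite gt_eqF// addr_gt0.
have logisticD : is_derive x 1 logistic (- (1 + expR x) ^- 2 *: (0 + expR x)).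
  exact: is_deriveV.
apply: is_derive_eq; rewrite !hornerE /GRing.scale/= /logistic; field.
exact: x1.
Qed.

(* The derivatives of the logistic function are polynomials in it. *)
Definition logistic_poly n : {poly R} :=
  iter n (fun p => p^`() * ('X^2 - 'X)) 'X.

Lemma is_derive_logistic_poly n x :
  is_derive x 1 (fun y => (logistic_poly n).[logistic y])
    (logistic_poly n.+1).[logistic x].
Proof.
rewrite /logistic_poly iterS hornerM.
exact: is_derive1_comp (is_derive_poly _ _) (is_derive_logistic x).
Qed.

Lemma norm_logistic_poly1_le1 x : `|(logistic_poly 1).[logistic x]| <= 1.
Proof.
have := logistic_gt0 x; have := logistic_lt1 x; set p := logistic x => p1 p0.
rewrite /logistic_poly/= derivX !hornerE ler_norml; apply/andP; split; nra.
Qed.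

Lemma norm_logistic_poly3_le1 x : `|(logistic_poly 3).[logistic x]| <= 1.
Proof.
have := logistic_gt0 x; have := logistic_lt1 x; set p := logistic x => p1 p0.
have -> : (logistic_poly 3).[p] = (6 * p ^+ 2 - 6 * p + 1) * (p ^+ 2 - p).
  rewrite /logistic_poly/= derivX mul1r !(derivM, derivB, derivXn, derivX, derivMn).
  by rewrite /= derivC !hornerE/=; ring.
rewrite normrM -[leRHS]mulr1 ler_pM// ler_norml; apply/andP; split; nra.
Qed.

End logistic.

Section step.
Context (R : realType).
Implicit Types (a h x y : R) (n : nat).

Definition step a h x : R := logistic ((x - a) / h).

Lemma step_ge0 a h x : 0 <= step a h x.
Proof. exact/ltW/logistic_gt0. Qed.

Lemma step_le1 a h x : step a h x <= 1.
Proof. exact/ltW/logistic_lt1. Qed.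

Definition step_deriv a h n x : R :=
  (logistic_poly R n).[logistic ((x - a) / h)] / h ^+ n.

Lemma step_deriv0 a h : step_deriv a h 0 = step a h.
Proof. by apply/funext => x; rewrite /step_deriv hornerX divr1. Qed.

Lemma is_derive_step_deriv a h n x :
  is_derive x 1 (step_deriv a h n) (step_deriv a h n.+1 x).
Proof.
have affineD : is_derive x 1 (fun x : R => (x - a) / h) h^-1.
  by apply: is_derive_eq; rewrite /GRing.scale/= subr0 mulr1 mulr0 add0r.
have compD := @is_derive1_comp _ (fun z => (logistic_poly R n).[logistic z])
  (fun x => (x - a) / h) x _ _ (is_derive_logistic_poly n _) affineD.
apply: (is_derive_eq (is_deriveM compD (is_derive_cst (h ^- n) x 1))).
by rewrite scaler0 add0r /step_deriv exprS invfM [RHS]mulrA; exact: mulrC.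
Qed.

Lemma continuous_step a h : continuous (step a h).
Proof.
rewrite -step_deriv0.
exact: (@is_derive_continuous _ _ _ (is_derive_step_deriv a h 0)).
Qed.

Lemma ge0_measurable_step a h : ge0_measurable (EFin \o step a h).
Proof.
apply: ge0_measurable_EFin; last exact: step_ge0.
by apply: continuous_measurable_fun; exact: continuous_step.
Qed.

Lemma norm_step_deriv1_le a h x : 0 < h -> `|step_deriv a h 1 x| <= h^-1.
Proof.
move=> h0; rewrite normrM (@gtr0_norm _ (h ^+ 1)^-1) ?invr_gt0//.
by rewrite ler_piMl ?norm_logistic_poly1_le1// invr_ge0 ltW.
Qed.

Lemma norm_step_deriv3_le a h x : 0 < h -> `|step_deriv a h 3 x| <= h ^- 3.
Proof.
move=> h0; rewrite normrM (@gtr0_norm _ (h ^- 3)) ?invr_gt0 ?exprn_gt0//.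
by rewrite ler_piMl ?norm_logistic_poly3_le1// invr_ge0 exprn_ge0// ltW.
Qed.

Lemma step_lipschitz a h x y : 0 < h -> step a h x <= step a h y + `|x - y| / h.
Proof.
move=> h0; rewrite -lerBlDl (le_trans (ler_norm _))//.
have := @taylor_le R (step_deriv a h) 1 h^-1
  (fun n z _ => is_derive_step_deriv a h n z)
  (fun z => norm_step_deriv1_le a z h0) y (x - y).
by rewrite step_deriv0 subrKC horner_poly big_ord1 step_deriv0 fact0 expr0
  divr1 mulr1 expr1 divr1 mulrC.
Qed.

End step.

Section levy_step.
Context (R : realType).
Implicit Types (mu nu : law R) (a h y d : R).

Let le_integral_Dr mu f g d : ge0_measurable (EFin \o f) ->
  ge0_measurable (EFin \o g) -> 0 <= d -> (forall x, f x <= g x + d) ->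
  (\int[mu]_x (f x)%:E <= \int[mu]_x (g x)%:E + d%:E)%E.
Proof.
move=> [mf f0] gmg d0 fg; rewrite -(ge0_integralDr_cst mu gmg d0).
apply: ge0_le_integral => //.
- by move=> x _; exact: f0.
- by have [] := ge0_measurableDr gmg d0.
- by move=> x _; rewrite -EFinD lee_fin fg.
Qed.

Lemma cdf_le_integral_step mu a h y : 0 < h ->
  (mu `]-oo, a]%classic <=
   \int[mu]_x (step (a + y) h x)%:E + (expR (- (y / h)))%:E)%E.
Proof.
move=> h0; rewrite -integral_indicT//.
apply: le_integral_Dr; first exact: ge0_measurable_indic.
- exact: ge0_measurable_step.
- exact: expR_ge0.
move=> x; rewrite indicE; case: (boolP (x \in _)) => [|_]; last first.
  by rewrite addr_ge0 ?step_ge0 ?expR_ge0.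
rewrite inE/= in_itv/= => xa; rewrite /step -lerBlDl -logisticN.
apply: (le_trans (logistic_le_expRN _)); rewrite opprK ler_expR -mulNr.
by rewrite ler_pM2r ?invr_gt0//; lra.
Qed.

Lemma integral_step_le_cdf mu a h y : 0 < h ->
  (\int[mu]_x (step a h x)%:E <=
   mu `]-oo, (a + y)%R]%classic + (expR (- (y / h)))%:E)%E.
Proof.
move=> h0; rewrite -integral_indicT//.
apply: le_integral_Dr; first exact: ge0_measurable_step.
- exact: ge0_measurable_indic.
- exact: expR_ge0.
move=> x; rewrite indicE; case: (boolP (x \in _)) => [_|].
  by rewrite ler_wpDr ?expR_ge0// step_le1.
rewrite notin_setE/= in_itv/= => /negP; rewrite -ltNge => xa; rewrite add0r.
apply: (le_trans (logistic_le_expRN _)); rewrite ler_expR lerN2.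
by rewrite ler_pM2r ?invr_gt0//; lra.
Qed.

Lemma le_law_cdf_step mu nu h y d : 0 < h ->
  (forall a, \int[mu]_x (step a h x)%:E <=
             \int[nu]_x (step a h x)%:E + d%:E)%E ->
  forall a, law_cdf mu a <= law_cdf nu (a + 2 * y) + (2 * expR (- (y / h)) + d).
Proof.
move=> h0 mu_nu a; set q := expR (- (y / h)).
rewrite -lee_fin EFinD /law_cdf !fineK ?fin_num_measure//.
apply: (le_trans (cdf_le_integral_step mu a y h0)).
apply: (le_trans (leeD2r _ (mu_nu _))).
rewrite -addeA; apply: (le_trans (leeD2r _ (integral_step_le_cdf nu (a + y) y h0))).
rewrite (_ : a + y + y = a + 2 * y); last by ring.
by rewrite -addeA leeD2l// -!EFinD lee_fin /q; lra.
Qed.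

(* [h] is chosen so that the error [2 * expR (- (y / h))] at [y = e / 4] is at
   most [e / 4]. *)
Lemma levy_dist_lt_step (e : R) : 0 < e -> exists h d : R, [/\ 0 < h, 0 < d &
  forall mu nu,
  (forall a, \int[mu]_x (step a h x)%:E <= \int[nu]_x (step a h x)%:E + d%:E)%E ->
  (forall a, \int[nu]_x (step a h x)%:E <= \int[mu]_x (step a h x)%:E + d%:E)%E ->
  levy_dist mu nu < e].
Proof.
move=> e0; exists (e ^+ 2 / 32), (e / 4).
have h0 : 0 < e ^+ 2 / 32 by rewrite divr_gt0 ?exprn_gt0.
split=> //; first by rewrite divr_gt0.
move=> mu nu mu_nu nu_mu.
have tail : expR (- ((e / 4) / (e ^+ 2 / 32))) <= e / 8.
  have -> : (e / 4) / (e ^+ 2 / 32) = 8 / e by field; rewrite gt_eqF.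
  rewrite expRN invf_ple ?posrE ?expR_gt0 ?divr_gt0// invf_div.
  by rewrite (le_trans _ (expR_ge1Dx _))// lerDr.
have cdf_le (m n : law R) : (forall a, \int[m]_x (step a (e ^+ 2 / 32) x)%:E <=
      \int[n]_x (step a (e ^+ 2 / 32) x)%:E + (e / 4)%:E)%E ->
    forall a, law_cdf m a <= law_cdf n (a + e / 2) + e / 2.
  move=> mn a; have := le_law_cdf_step (e / 4) h0 mn a.
  rewrite (_ : 2 * (e / 4) = e / 2); last by field.
  by move=> /le_trans; apply; rewrite lerD2l; lra.
apply: (@le_lt_trans _ _ (e / 2)); last by rewrite ltr_pdivrMr// ltr_pMr// ltr1n.
apply: levy_dist_le; split; first by rewrite divr_gt0.
move=> x; apply/andP; split; last exact: cdf_le.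
by rewrite lerBlDr; have := cdf_le _ _ mu_nu (x - e / 2); rewrite subrK.
Qed.

End levy_step.

Section integral_density.
Context d (T : measurableType d) (R : realType).
Variables (nu : {finite_measure set T -> \bar R}).
Variables (mu : {sigma_finite_measure set T -> \bar R}) (p : T -> R).
Hypotheses (mp : measurable_fun setT p) (p0 : forall x, 0 <= p x).
Local Open Scope ereal_scope.
Hypothesis nuE : forall A, measurable A -> nu A = \int[mu]_(x in A) (p x)%:E.

Let mpE : measurable_fun setT (EFin \o p). Proof. exact/measurable_EFinP. Qed.

Let nu_mu : nu `<< mu.
Proof.
apply/null_content_dominatesP => A mA muA0; rewrite nuE// null_set_integral//.
exact: measurable_funTS.
Qed.

Lemma ge0_integral_density (f : T -> \bar R) : measurable_fun setT f ->
  (forall x, 0 <= f x) -> \int[nu]_x f x = \int[mu]_x (f x * (p x)%:E).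
Proof.
move=> mf f0; rewrite -(Radon_Nikodym_SigmaFinite.change_of_variables nu_mu)//.
set p' := Radon_Nikodym_SigmaFinite.f nu mu.
have p'_int : mu.-integrable setT p'.
  exact: Radon_Nikodym_SigmaFinite.f_integrable.
have mp' := measurable_int _ p'_int.
have p'p : ae_eq mu setT p' (EFin \o p).
  apply: integral_ae_eq => // A _ mA.
  by rewrite -Radon_Nikodym_SigmaFinite.f_integral// nuE.
apply: ae_eq_integral => //.
- exact: emeasurable_funM mf mp'.
- exact: emeasurable_funM mf mpE.
- by apply: filterS p'p => x /[swap] _ /(_ I) ->.
Qed.

Lemma integral_density (f : T -> \bar R) : measurable_fun setT f ->
  \int[nu]_x f x = \int[mu]_x (f x * (p x)%:E).
Proof.
move=> mf; rewrite integralE [RHS]integralE; congr (_ - _).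
- rewrite ge0_integral_density//; last exact: measurable_funepos.
  apply: eq_integral => x _; rewrite !funeposE maxe_pMl ?lee_fin//.
  by rewrite mul0e.
- rewrite ge0_integral_density//; last exact: measurable_funeneg.
  apply: eq_integral => x _; rewrite !funenegE maxe_pMl ?lee_fin//.
  by rewrite mul0e mulNe.
Qed.

Lemma integrable_density (f : T -> \bar R) : measurable_fun setT f ->
  nu.-integrable setT f <-> mu.-integrable setT (fun x => f x * (p x)%:E).
Proof.
move=> mf; have mfp : measurable_fun setT (fun x => f x * (p x)%:E).
  exact: emeasurable_funM mf mpE.
have abse_int : \int[nu]_x `|f x| = \int[mu]_x `|f x * (p x)%:E|.
  rewrite integral_density; last exact: measurableT_comp.
  by apply: eq_integral => x _; rewrite abseM (@gee0_abs _ (p x)%:E)// lee_fin.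
by split=> /integrableP[_ int_lty]; apply/integrableP; split=> //;
  [rewrite -abse_int|rewrite abse_int].
Qed.

End integral_density.

Section lebesgue_integral.
Context (R : realType).
Local Notation mR := (measurableTypeR R).
Local Notation leb := (@lebesgue_measure R).

Lemma lebesgue_integral_affine (D : set R) (f : R -> \bar R) (a b : R) :
  0 < a -> measurable D -> ge0_measurable f ->
  (\int[leb]_(x in D) f x =
   a%:E * \int[leb]_(x in (fun x => a * x + b)%R @^-1` D) f (a * x + b)%R)%E.
Proof.
move=> a0 mD [mf f0]; pose g (x : mR) : mR := a * x + b.
have mg : measurable_fun setT g.
  by apply: measurable_funD => //; exact: mulrl_measurable.
have a_ge0 : 0 <= a by exact: ltW.
have mfD : measurable_fun (D : set mR) f by exact: measurable_funTS.
have [image imageE] : exists2 image : {measure set mR -> \bar R},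
    forall A, image A = leb (g @^-1` A) &
    (\int[image]_(x in D) f x = \int[leb]_(x in g @^-1` D) f (g x))%E.
  unshelve eexists (pushforward leb g) => //.
  by rewrite ge0_integral_pushforward.
move=> image_int; rewrite -[X in (_ * X)%E]image_int.
transitivity (\int[mscale (NngNum a_ge0) image]_(x in D) f x)%E; last first.
  by rewrite ge0_integral_mscale.
apply: eq_measure_integral => A mA _; apply: lebesgue_measure_unique => //.
move=> _ [[c d]] _ <-; rewrite /= /mscale/= imageE.
rewrite (_ : _ @^-1` _ = `]((c - b) / a), ((d - b) / a)]%classic); last first.
  apply/seteqP; split => x /=; rewrite !in_itv/= ltr_pdivrMr// ler_pdivlMr//;
    by rewrite ltrBlDr lerBrDr mulrC.
rewrite !lebesgue_measure_itv/= !lte_fin ltr_pM2r ?invr_gt0// ltrD2r.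
case: ifP => _; last by rewrite mule0.
by rewrite -!EFinB -EFinM; congr EFin; field; rewrite gt_eqF.
Qed.

Lemma integral_itv_is_derive (f F : R -> R) (a b : R) : a < b ->
  (forall x : R, is_derive x 1 F (f x)) -> continuous f ->
  (\int[leb]_(x in `[a, b]) (f x)%:E = (F b - F a)%R%:E)%E.
Proof.
move=> ab Ff cf; have cF := @is_derive_continuous _ _ _ Ff.
rewrite (@continuous_FTC2 _ _ F)//.
- exact: continuous_subspaceT.
- split.
  + by move=> x _; have [] := Ff x.
  + by apply: cvg_at_right_filter; exact: cF.
  + by apply: cvg_at_left_filter; exact: cF.
- by move=> x _; rewrite derive1E; have [_ ->] := Ff x.
Qed.

Lemma Rintegral_is_derive (f F : R -> R) (l : R) :
  (forall x : R, is_derive x 1 F (f x)) -> continuous f ->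
  leb.-integrable setT (EFin \o f) ->
  F x - F (- x) @[x --> +oo] --> l -> \int[leb]_x f x = l.
Proof.
move=> Ff cf intf Fl; have mf : measurable_fun setT f.
  exact: continuous_measurable_fun.
pose trunc n : mR -> \bar R := (EFin \o f) \_ `[(- n%:R : R), n%:R].
have truncE n : (\int[leb]_x trunc n.+1 x = (F n.+1%:R - F (- n.+1%:R))%R%:E)%E.
  rewrite -integral_mkcond (@integral_itv_is_derive f F)//.
  by rewrite gtrN.
have trunc_cvg : (\int[leb]_x trunc n x)%E @[n --> \oo] -->
    (\int[leb]_x (f x)%:E)%E.
  apply: (@dominated_cvg _ _ _ leb setT measurableT trunc (EFin \o f)
    (abse \o (EFin \o f))) => //.
  - move=> n; apply/(measurable_restrictT _ _).1 => //.
    exact/measurable_EFinP/measurable_funTS.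
  - move=> x _; apply: cvg_near_cst; near=> n; rewrite /trunc patchE mem_set//=.
    rewrite in_itv/= -ler_norml; near: n; exact: nbhs_infty_ger.
  - exact: integrable_abse.
  - move=> n x _; rewrite /trunc patchE; case: ifP => // _.
    by rewrite abse0 abse_ge0.
have trunc_l : (\int[leb]_x trunc n x)%E @[n --> \oo] --> l%:E.
  rewrite -cvg_shiftS; under eq_fun do rewrite /= truncE.
  have Fnl : F n%:R - F (- n%:R) @[n --> \oo] --> l.
    exact: (cvg_comp (fun n => n%:R) (fun x => F x - F (- x)) (@cvgr_idn R)).
  by move: Fnl; rewrite -cvg_shiftS => Fnl; exact: (cvg_comp _ _ Fnl).
by rewrite /Rintegral (cvg_unique _ trunc_cvg trunc_l).
Unshelve. all: by end_near. Qed.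

End lebesgue_integral.

Section integrable_polynomials.
Context (R : realType).
Local Notation mR := (measurableTypeR R).
Variables (mu : probability mR R) (n : nat).
Hypothesis int_n : mu.-integrable setT (fun x => (`|x| ^+ n)%:E).
Implicit Types (p : {poly R}) (k : nat).

Lemma integrable_expr_le k : (k <= n)%N ->
  mu.-integrable setT (fun x : mR => (x ^+ k)%:E).
Proof.
move=> kn; have int1 : mu.-integrable setT (cst 1%E).
  exact: finite_measure_integrable_cst.
apply: (le_integrable _ _ _ (integrableD _ int1 int_n)) => //.
  exact/measurable_EFinP/measurable_funX.
move=> x _; rewrite /= lee_fin normrX.
rewrite [leRHS]ger0_norm; last by rewrite addr_ge0// exprn_ge0.
have [x1|x1] := leP `|x| 1.
  by rewrite ler_wpDr ?exprn_ge0// exprn_ile1.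
by rewrite ler_wpDl// ler_weXn2l// ltW.
Qed.

Lemma integrable_horner p : (size p <= n.+1)%N ->
  mu.-integrable setT (EFin \o horner p).
Proof.
move=> pn; rewrite (_ : EFin \o _ =
    (fun x : mR => \sum_(i < n.+1) (p`_i)%:E * (x ^+ i)%:E)%E).
  apply: integrable_sum => // i _; apply: integrableZl => //.
  by apply: integrable_expr_le; rewrite -ltnS.
by apply/funext => x /=; rewrite (horner_coef_wide x pn) -sumEFin.
Qed.

Lemma Rintegral_horner p : (size p <= n.+1)%N ->
  \int[mu]_x p.[x] = \sum_(i < n.+1) p`_i * \int[mu]_x x ^+ i.
Proof.
move=> pn; have int_expr (i : 'I_n.+1) := integrable_expr_le (ltn_ord i : i <= n)%N.
rewrite /Rintegral; under eq_integral => x _.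
  rewrite (horner_coef_wide x pn) -sumEFin; under eq_bigr do rewrite EFinM; over.
rewrite integral_sum//; last by move=> i; exact: integrableZl.
rewrite -sum_fine => [|i _]; last first.
  by rewrite integralZl// fin_numM// integrable_fin_num.
by apply: eq_bigr => i _; rewrite integralZl// fineM// integrable_fin_num.
Qed.

End integrable_polynomials.

Section centered_moments.
Context (R : realType).
Local Notation mR := (measurableTypeR R).
Implicit Types (mu nu : probability mR R) (v r K x : R).

Lemma integrable_normX mu n : (\int[mu]_x (`|x| ^+ n)%:E < +oo)%E ->
  mu.-integrable setT (fun x => (`|x| ^+ n)%:E).
Proof.
move=> int_lty; apply/integrableP; split.
  exact: (ge0_measurable_normX R n).1.
by under eq_integral do rewrite /= ger0_norm ?exprn_ge0//.
Qed.

Definition centered_moments mu v r :=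
  [/\ \int[mu]_x x = 0, \int[mu]_x x ^+ 2 = v &
      (\int[mu]_x (`|x| ^+ 3)%:E <= r%:E)%E].

Lemma centered_moments_ge0 mu v r : centered_moments mu v r -> 0 <= r.
Proof.
move=> [_ _ third]; rewrite -lee_fin; apply: le_trans third.
by apply: integral_ge0 => x _; rewrite lee_fin exprn_ge0.
Qed.

Lemma centered_moments_integrable mu v r : centered_moments mu v r ->
  mu.-integrable setT (fun x => (`|x| ^+ 3)%:E).
Proof.
by move=> [_ _ third]; apply: integrable_normX; rewrite (le_lt_trans third)// ltry.
Qed.

Lemma Rintegral_taylor3 (g : nat -> R -> R) mu v r x : centered_moments mu v r ->
  \int[mu]_y (taylor_poly g 3 x).[y] = g 0%N x + g 2 x * v / 2.
Proof.
move=> mom; have int3 := centered_moments_integrable mom.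
have [mean var _] := mom; have mass : fine (mu [set: mR]) = 1.
  by rewrite probability_setT.
rewrite (Rintegral_horner int3) ?(leq_trans (size_poly _ _))//.
rewrite !big_ord_recr big_ord0 !coef_poly/=; under eq_Rintegral do rewrite expr0.
rewrite Rintegral_cst// mass; under eq_Rintegral do rewrite expr1.
by rewrite mean var (_ : 2`! = 2%N)// (_ : 1`! = 1%N)// fact0; field.
Qed.

Section third_order_taylor.
Variables (g : nat -> R -> R) (K : R).
Hypothesis gD : forall k x, is_derive x 1 (g k) (g k.+1 x).
Hypothesis gK : forall x, `|g 3 x| <= K.

Lemma average_taylor mu v r x : centered_moments mu v r ->
  exists2 I, average mu (EFin \o g 0%N) x = I%:E &
    `|I - (g 0%N x + g 2 x * v / 2)| <= K * r / 6.
Proof.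
move=> mom; have int3 := centered_moments_integrable mom.
have [_ _ third] := mom.
pose p := taylor_poly g 3 x; pose rem (y : R) : R := g 0%N (x + y) - p.[y].
have K0 : 0 <= K by exact: le_trans (gK 0).
have rem_le y : `|rem y| <= K / 6 * `|y| ^+ 3.
  have := taylor_le (fun k z _ => gD k z) gK x y.
  by rewrite [leRHS]mulrA [leRHS]mulrAC.
have size_p : (size p <= 4)%N by apply: leq_trans (size_poly _ _) _.
have int_p : mu.-integrable setT (EFin \o horner p).
  exact: (integrable_horner int3 size_p).
have int_bound : mu.-integrable setT (fun y : mR => (K / 6)%:E * (`|y| ^+ 3)%:E)%E.
  exact: integrableZl.
have cg : continuous (fun y => g 0%N (x + y)).
  move=> y; apply: (@continuous_comp _ _ _ (fun y => x + y) (g 0%N)).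
    by apply: cvgD; [exact: cvg_cst|exact: cvg_id].
  exact: (@is_derive_continuous _ _ _ (gD 0%N)).
have mrem : measurable_fun setT rem.
  by apply: measurable_funB; apply: continuous_measurable_fun => //;
    exact: continuous_horner.
have int_rem : mu.-integrable setT (EFin \o rem).
  apply: le_integrable int_bound => //; first exact/measurable_EFinP.
  move=> y _; rewrite /= lee_fin [leRHS]ger0_norm ?rem_le//.
  by rewrite mulr_ge0 ?divr_ge0 ?exprn_ge0.
have g_split y : g 0%N (x + y) = p.[y] + rem y by rewrite /rem subrKC.
exists (\int[mu]_y g 0%N (x + y)).
  rewrite /Rintegral fineK//; apply: integrable_fin_num => //.
  under eq_fun do rewrite g_split EFinD.
  exact: integrableD.
under eq_Rintegral do rewrite g_split.
rewrite RintegralD// (Rintegral_taylor3 g x mom) addrC addKr.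
rewrite (le_trans (le_normr_Rintegral _ _))//.
rewrite (@le_trans _ _ (\int[mu]_y (K / 6 * `|y| ^+ 3)))//.
  by apply: le_Rintegral => //; exact: integrable_norm.
rewrite RintegralZl// [leRHS]mulrAC ler_wpM2l ?divr_ge0//.
by rewrite -lee_fin fineK// integrable_fin_num.
Qed.

Lemma average_le_of_moments mu nu v r r' x :
  centered_moments mu v r -> centered_moments nu v r' ->
  (average mu (EFin \o g 0%N) x <=
   average nu (EFin \o g 0%N) x + (K * (r + r') / 6)%:E)%E.
Proof.
move=> /average_taylor-/(_ x)[I -> muI] /average_taylor-/(_ x)[J -> nuJ].
by move: muI nuJ; rewrite -EFinD lee_fin !ler_norml => /andP[_ +] /andP[+ _]; lra.
Qed.

Lemma lindeberg_replacement (I : eqType) (s : seq I) (M N : I -> probability mR R)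
    (v r r' : I -> R) x :
  (forall y, 0 <= g 0%N y) ->
  (forall i, i \in s -> centered_moments (M i) (v i) (r i)) ->
  (forall i, i \in s -> centered_moments (N i) (v i) (r' i)) ->
  (averages (map M s) (EFin \o g 0%N) x <=
   averages (map N s) (EFin \o g 0%N) x +
   (K / 6 * \sum_(i <- s) (r i + r' i))%:E)%E.
Proof.
move=> g_ge0 momM momN; have K0 : 0 <= K by exact: le_trans (gK 0).
have gmg : ge0_measurable (EFin \o g 0%N).
  apply: ge0_measurable_EFin => //; apply: continuous_measurable_fun.
  exact: (@is_derive_continuous _ _ _ (gD 0%N)).
rewrite mulr_sumr; apply: le_averages_sum => // [i si|i y si].
  rewrite mulr_ge0 ?divr_ge0// addr_ge0//.
    exact: centered_moments_ge0 (momM _ si).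
  exact: centered_moments_ge0 (momN _ si).
by rewrite mulrAC; apply: average_le_of_moments; [exact: momM|exact: momN].
Qed.

End third_order_taylor.

End centered_moments.

Section centered_uniform.
Context (R : realType).
Local Notation mR := (measurableTypeR R).
Local Notation leb := (@lebesgue_measure R).
Local Notation unif := (@centered_uniform R).
Implicit Types (s t x : R).

Lemma centered_uniformE t : 0 < t ->
  exists ab : - (t / 2) < t / 2, unif t = uniform_prob ab.
Proof.
move=> t0; rewrite /centered_uniform; case: pselect => [ab|]; first by exists ab.
by move=> /negP; rewrite -leNgt => h; exfalso; lra.
Qed.

Lemma integral_centered_uniform t (f : R -> \bar R) : 0 < t ->
  measurable_fun setT f ->
  (\int[unif t]_x f x =
   \int[leb]_(x in `[(- (t / 2))%R, (t / 2)%R]) (f x * (t^-1)%:E))%E.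
Proof.
move=> t0 mf; have [ab ->] := centered_uniformE t0.
rewrite (@integral_density _ _ _ (uniform_prob ab) leb
  (uniform_pdf (- (t / 2)) (t / 2)))//; last 2 first.
- exact: measurable_uniform_pdf.
- by move=> x; exact: uniform_pdf_ge0.
rewrite [RHS]integral_mkcond; apply: eq_integral => x _.
rewrite patchE mem_setE /uniform_pdf in_itv/=.
case: ifP => _; last by rewrite mule0.
by congr (_ * _%:E)%E; congr GRing.inv; field.
Qed.

Lemma integral_centered_uniform_is_derive t (f F : R -> R) : 0 < t ->
  (forall x : R, is_derive x 1 F (f x)) -> continuous f ->
  (\int[unif t]_x (f x)%:E = ((F (t / 2) - F (- (t / 2))) / t)%R%:E)%E.
Proof.
move=> t0 Ff cf; rewrite integral_centered_uniform//; last first.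
  by apply/measurable_EFinP; exact: continuous_measurable_fun.
under eq_integral do rewrite -EFinM.
have quotD (x : R) : is_derive x 1 (fun x => F x / t) (f x / t).
  apply: (is_derive_eq (is_deriveM (Ff x) (is_derive_cst t^-1 x 1))).
  by rewrite scaler0 add0r; exact: mulrC.
rewrite (integral_itv_is_derive _ quotD); first by rewrite -mulrBl.
  by lra.
by move=> x; apply: cvgM; [exact: cf|exact: cvg_cst].
Qed.

Lemma ge0_integral_centered_uniform_le t (f : R -> \bar R) (c : R) : 0 < t ->
  ge0_measurable f -> (forall x, `|x| <= t / 2 -> (f x <= c%:E)%E) ->
  (\int[unif t]_x f x <= c%:E)%E.
Proof.
move=> t0 [mf f0] fc; rewrite integral_centered_uniform//.
apply: (@le_trans _ _
    (\int[leb]_(x in `[(- (t / 2))%R, (t / 2)%R]) (c / t)%:E)%E).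
  apply: ge0_le_integral => //.
  - by move=> x _; rewrite mule_ge0// lee_fin invr_ge0 ltW.
  - by apply: measurable_funTS; exact: emeasurable_funM.
  - move=> x /=; rewrite in_itv/= -ler_norml => /fc fxc.
    by rewrite EFinM lee_wpmul2r// lee_fin invr_ge0 ltW.
rewrite integral_cst//= lebesgue_measure_itv/= lte_fin ifT; last by lra.
by rewrite -EFinB -EFinM lee_fin le_eqVlt; apply/orP; left; apply/eqP; field; lra.
Qed.

Lemma centered_moments_uniform t : 0 < t ->
  centered_moments (unif t) (t ^+ 2 / 12) (t ^+ 3).
Proof.
move=> t0; split.
- have antiderivative (x : R) : is_derive x 1 (fun x : R => x ^+ 2 / 2) x.
    by apply: is_derive_eq; rewrite /GRing.scale/=; field.
  rewrite /Rintegral (integral_centered_uniform_is_derive t0 antiderivative)/=.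
    by rewrite sqrrN subrr mul0r.
  by move=> x; exact: cvg_id.
- have antiderivative (x : R) : is_derive x 1 (fun x : R => x ^+ 3 / 3) (x ^+ 2).
    by apply: is_derive_eq; rewrite /GRing.scale/=; field.
  rewrite /Rintegral (integral_centered_uniform_is_derive t0 antiderivative)/=.
    by field; lra.
  exact: exprn_continuous.
- apply: (ge0_integral_centered_uniform_le t0 (ge0_measurable_normX R 3)) => x xt.
  by rewrite lee_fin lerXn2r ?nnegrE ?(ltW t0)// (le_trans xt)//; lra.
Qed.

Lemma ge0_integral_centered_uniform_scale t (f : R -> \bar R) : 0 <= t ->
  ge0_measurable f -> (\int[unif t]_x f x = \int[unif 1]_x f (t * x)%R)%E.
Proof.
move=> + gmf; have [mf f0] := gmf; rewrite le_eqVlt => /predU1P[<-|t0].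
  under [RHS]eq_integral do rewrite mul0r.
  rewrite centered_uniform0 integral_dirac// diracT mul1e.
  by rewrite integral_cst//= probability_setT mule1.
have [mft ft0] : ge0_measurable (fun x => f (t * x)%R).
  by apply: ge0_measurable_comp gmf; exact: mulrl_measurable.
have tV0 : (0 <= (t^-1)%:E)%E by rewrite lee_fin invr_ge0 ltW.
have gmfV : ge0_measurable (fun x => f x * (t^-1)%:E)%E.
  by split=> [|x]; [exact: emeasurable_funM|rewrite mule_ge0].
rewrite !integral_centered_uniform// (lebesgue_integral_affine 0 t0 _ gmfV)//.
rewrite (_ : _ @^-1` _ = `[(- (1 / 2))%R, (1 / 2)%R]%classic); last first.
  by apply/seteqP; split => x /=;
    rewrite !in_itv/= addr0 !div1r -mulrN !ler_pM2l.
rewrite -ge0_integralZl//; last 3 first.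
- apply: measurable_funTS; apply: emeasurable_funM => //.
  by under eq_fun do rewrite addr0.
- by move=> x _; have [_] := gmfV; exact.
- by rewrite lee_fin ltW.
apply: eq_integral => x _; rewrite addr0 invr1 mule1.
by rewrite muleCA -EFinM divff ?gt_eqF// mule1.
Qed.

Lemma average_centered_uniform_lipschitz (f : R -> R) K s t x :
  ge0_measurable (EFin \o f) ->
  (forall y z, f y <= f z + K * `|y - z|) -> 0 <= K -> 0 <= s -> 0 <= t ->
  (average (unif s) (EFin \o f) x <=
   average (unif t) (EFin \o f) x + (K * `|s - t|)%:E)%E.
Proof.
move=> gmf fK K0 s0 t0; have gmfx := ge0_measurable_shift x gmf.
rewrite /average (ge0_integral_centered_uniform_scale s0)//.
rewrite (ge0_integral_centered_uniform_scale t0)//.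
have gm_scaled c : ge0_measurable (fun y => (f (x + c * y))%:E).
  by apply: ge0_measurable_comp gmfx; exact: mulrl_measurable.
have gm_norm : ge0_measurable (fun y : R => `|y|%:E) := ge0_measurable_normX R 1.
have [ms fs0] := gm_scaled s; have [mt ft0] := gm_scaled t.
have [mnorm norm_ge0] := gm_norm.
have c0 : (0 <= (K * `|s - t|)%:E)%E by rewrite lee_fin mulr_ge0.
have mc : measurable_fun setT (fun y : R => (K * `|s - t|)%:E * `|y|%:E)%E.
  exact: measurable_funeM.
apply: (@le_trans _ _ (\int[unif 1]_y
    ((f (x + t * y))%:E + (K * `|s - t|)%:E * `|y|%:E))%E).
  apply: ge0_le_integral => //.
  - by move=> y _; exact: fs0.
  - by apply: emeasurable_funD; [exact: mt|exact: mc].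
  move=> y _; rewrite -EFinM -EFinD lee_fin (le_trans (fK _ (x + t * y)))//.
  by rewrite (_ : _ - _ = (s - t) * y) ?normrM ?mulrA//; ring.
rewrite ge0_integralD//; last by move=> y _; exact: mule_ge0.
rewrite leeD2l// ge0_integralZl//.
rewrite -[leRHS]mule1 lee_wpmul2l//.
apply: (ge0_integral_centered_uniform_le ltr01 gm_norm) => y y1.
by rewrite lee_fin; lra.
Qed.

End centered_uniform.

Section normal_moments.
Context (R : realType).
Local Notation mR := (measurableTypeR R).
Local Notation leb := (@lebesgue_measure R).
Implicit Types (m s x : R) (f : R -> R).

Lemma integral_normal_prob m s (f : R -> \bar R) : measurable_fun setT f ->
  (\int[normal_prob m s]_x f x = \int[leb]_x (f x * (normal_pdf m s x)%:E))%E.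
Proof.
move=> mf; apply: (@integral_density _ _ _ (normal_prob m s) leb) => //.
- exact: measurable_normal_pdf.
- by move=> x; exact: normal_pdf_ge0.
Qed.

Lemma Rintegral_normal_prob m s f : measurable_fun setT f ->
  \int[normal_prob m s]_x f x = \int[leb]_x (f x * normal_pdf m s x).
Proof.
move=> mf; rewrite /Rintegral integral_normal_prob//; exact/measurable_EFinP.
Qed.

Lemma integrable_normal_prob m s f : measurable_fun setT f ->
  (normal_prob m s).-integrable setT (EFin \o f) <->
  leb.-integrable setT (fun x : mR => (f x * normal_pdf m s x)%:E).
Proof.
move=> mf; apply: (@integrable_density _ _ _ (normal_prob m s) leb) => //.
- exact: measurable_normal_pdf.
- by move=> x; exact: normal_pdf_ge0.
- exact/measurable_EFinP.
Qed.

Lemma is_derive_normal_pdf m s x : s != 0 ->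
  is_derive x 1 (normal_pdf m s) (- (x - m) / s ^+ 2 * normal_pdf m s x).
Proof.
move=> s0; rewrite normal_pdfE//.
have expoD : is_derive x 1 (fun y : R => - (y - m) ^+ 2 / (s ^+ 2 *+ 2))
    (- (x - m) / s ^+ 2).
  by apply: is_derive_eq; rewrite /GRing.scale/=; field; exact: s0.
have normalD := @is_derive1_comp _ expR
  (fun y : R => - (y - m) ^+ 2 / (s ^+ 2 *+ 2)) x _ _ (is_derive_expR _) expoD.
apply: (is_derive_eq (is_deriveM (is_derive_cst (normal_peak s) x 1) normalD)).
by rewrite scaler0 addr0 /GRing.scale/= /normal_fun; ring.
Qed.

Lemma normal_pdf0N s x : s != 0 -> normal_pdf 0 s (- x) = normal_pdf 0 s x.
Proof. by move=> s0; rewrite !normal_pdfE// /normal_fun !subr0 sqrrN. Qed.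

Lemma cube_le_expR (w : R) : 0 <= w -> w ^+ 3 <= 32 * expR (3 * w ^+ 2 / 8).
Proof.
move=> w0; have := @expR_ge1Dxn R (3 * w ^+ 2 / 8) 1.
rewrite mulr_ge0 ?mulr_ge0 ?sqr_ge0// => /(_ isT) /(ler_wpM2l (ler0n R 32)).
apply: le_trans; rewrite (_ : 2`! = 2%N)//.
rewrite (_ : 32 * _ = 32 + 9 / 4 * (w * w ^+ 3)); last by field.
have [w1|/ltW w1] := leP w 1.
- rewrite ler_wpDr ?mulr_ge0 ?exprn_ge0//.
  by rewrite (le_trans (exprn_ile1 _ w0 w1))// ler1n.
- have : 0 <= w ^+ 3 by exact: exprn_ge0.
  by move: w1; set c := w ^+ 3 => w1 c0; nra.
Qed.

Lemma normal_peakZ s (c : R) : 0 < c -> normal_peak (c * s) = normal_peak s / c.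
Proof.
move=> c0; rewrite /normal_peak -invfM; congr GRing.inv.
rewrite exprMn -!mulrnAr -mulrA sqrtrM ?sqr_ge0// sqrtr_sqr gtr0_norm// mulrC.
by [].
Qed.

Lemma cube_normal_pdf_le s x : 0 < s ->
  `|x| ^+ 3 * normal_pdf 0 s x <= 64 * s ^+ 3 * normal_pdf 0 (2 * s) x.
Proof.
move=> s0; have s_neq0 : s != 0 by rewrite gt_eqF.
pose w := `|x| / s; have w0 : 0 <= w by rewrite divr_ge0// ltW.
have xE : `|x| = w * s by rewrite divfK.
have fun_split : normal_fun 0 (2 * s) x =
    normal_fun 0 s x * expR (3 * w ^+ 2 / 8).
  rewrite /normal_fun !subr0 -expRD -real_normK ?num_real// xE.
  by congr expR; field; exact: s_neq0.
rewrite !normal_pdfE ?mulf_neq0// normal_peakZ// fun_split xE exprMn.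
rewrite (_ : 64 * _ * _ = 32 * expR (3 * w ^+ 2 / 8) *
  (s ^+ 3 * (normal_peak s * normal_fun 0 s x))); last by field.
rewrite -[leLHS]mulrA ler_wpM2r ?cube_le_expR//.
by rewrite !mulr_ge0 ?exprn_ge0 ?normal_fun_ge0 ?normal_peak_ge0 ?(ltW s0).
Qed.

Lemma integral_cube_normal_le s : 0 < s ->
  (\int[normal_prob 0 s]_x (`|x| ^+ 3)%:E <= (64 * s ^+ 3)%:E)%E.
Proof.
move=> s0; have [mcube _] := ge0_measurable_normX R 3.
have mpdf c : measurable_fun setT (fun x : R => (normal_pdf 0 c x)%:E).
  by apply/measurable_EFinP; exact: measurable_normal_pdf.
rewrite integral_normal_prob// -[leRHS]mule1 -(integral_normal_pdf 0 (2 * s)).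
rewrite -ge0_integralZl//; last 3 first.
- exact: mpdf.
- by move=> x _; rewrite lee_fin normal_pdf_ge0.
- by rewrite lee_fin mulr_ge0// exprn_ge0// ltW.
apply: ge0_le_integral => //.
- by move=> x _; rewrite -EFinM lee_fin mulr_ge0 ?exprn_ge0 ?normal_pdf_ge0.
- by apply: emeasurable_funM; [exact: mcube|exact: mpdf].
- by apply: measurable_funeM; exact: mpdf.
- by move=> x _; rewrite -!EFinM lee_fin cube_normal_pdf_le.
Qed.

Lemma integrable_cube_normal s : 0 < s ->
  (normal_prob 0 s).-integrable setT (fun x => (`|x| ^+ 3)%:E).
Proof.
move=> s0; apply: integrable_normX.
by rewrite (le_lt_trans (integral_cube_normal_le s0))// ltry.
Qed.

Lemma integrable_expr_normal_pdf s k : 0 < s -> (k <= 3)%N ->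
  leb.-integrable setT (fun x : mR => (x ^+ k * normal_pdf 0 s x)%:E).
Proof.
move=> s0 k3; apply/integrable_normal_prob; first exact: measurable_funX.
exact: (integrable_expr_le (integrable_cube_normal s0) k3).
Qed.

Lemma cvg_mul_normal_pdf s : 0 < s -> x * normal_pdf 0 s x @[x --> +oo] --> (0 : R).
Proof.
move=> s0; set C := 64 * s ^+ 3 * normal_peak (2 * s).
have C0 : 0 <= C by rewrite !mulr_ge0 ?exprn_ge0 ?normal_peak_ge0 ?ltW.
apply/cvgrPdist_le => e e0; near=> x.
have x1 : 1 <= x by near: x; apply: nbhs_pinfty_ge; exact: num_real.
have x0 : 0 < x by rewrite (lt_le_trans ltr01).
rewrite sub0r normrN ger0_norm; last by rewrite mulr_ge0 ?normal_pdf_ge0// ltW.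
have cube_le : x ^+ 3 * normal_pdf 0 s x <= C.
  have := cube_normal_pdf_le x s0; rewrite ger0_norm ?(ltW x0)//.
  move=> /le_trans; apply.
  by rewrite ler_wpM2l ?normal_pdf_ub ?mulf_neq0 ?gt_eqF// mulr_ge0 ?exprn_ge0 ?ltW.
have Cx : C <= e * x ^+ 2.
  rewrite -ler_pdivrMl//; apply: (@le_trans _ _ x); last first.
    by rewrite expr2 ler_peMl ?ltW.
  by near: x; apply: nbhs_pinfty_ge; exact: num_real.
rewrite -(@ler_pM2l _ (x ^+ 2)) ?exprn_gt0//; apply: le_trans (le_trans cube_le _).
  by rewrite mulrA -exprSr.
by rewrite [leRHS]mulrC.
Unshelve. all: by end_near. Qed.

Lemma normal_mean s : 0 < s -> \int[normal_prob 0 s]_x x = 0.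
Proof.
move=> s0; have s_neq0 : s != 0 by rewrite gt_eqF.
rewrite Rintegral_normal_prob//.
apply: (@Rintegral_is_derive _ _ (fun x => - s ^+ 2 * normal_pdf 0 s x)).
- move=> x; have := is_deriveM (is_derive_cst (- s ^+ 2) x 1)
    (is_derive_normal_pdf 0 x s_neq0).
  move=> pdfD; apply: (is_derive_eq pdfD).
  by rewrite scaler0 addr0 /GRing.scale/= subr0; field.
- by move=> x; apply: cvgM; [exact: cvg_id|exact: continuous_normal_pdf].
- exact: (@integrable_expr_normal_pdf s 1).
- by under eq_fun do rewrite normal_pdf0N// subrr; exact: cvg_cst.
Qed.

Lemma normal_variance s : 0 < s -> \int[normal_prob 0 s]_x x ^+ 2 = s ^+ 2.
Proof.
move=> s0; have s_neq0 : s != 0 by rewrite gt_eqF.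
rewrite Rintegral_normal_prob; last exact: measurable_funX.
have int2 := @integrable_expr_normal_pdf s 2 s0 isT.
have int0 : leb.-integrable setT (fun x : mR => (s ^+ 2 * normal_pdf 0 s x)%:E).
  under eq_fun do rewrite EFinM.
  by apply: integrableZl => //; exact: integrable_normal_pdf.
have : \int[leb]_x (x ^+ 2 * normal_pdf 0 s x - s ^+ 2 * normal_pdf 0 s x) = 0.
  apply: (@Rintegral_is_derive _ _ (fun x => - s ^+ 2 * (x * normal_pdf 0 s x))).
  - move=> x; have idpdfD :=
      is_deriveM (is_derive_id x 1) (is_derive_normal_pdf 0 x s_neq0).
    apply: (is_derive_eq (is_deriveM (is_derive_cst (- s ^+ 2) x 1) idpdfD)).
    by rewrite scaler0 addr0 /GRing.scale/= subr0; field.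
  - have cpdf := @continuous_normal_pdf R 0 s s_neq0.
    move=> x; apply: cvgB; apply: cvgM; try exact: cpdf.
      exact: exprn_continuous.
    exact: cvg_cst.
  - exact: integrableB int2 int0.
  - rewrite (_ : (fun x => _) = (fun x => - (2 * s ^+ 2) * (x * normal_pdf 0 s x))).
      rewrite -[X in _ --> X](mulr0 (- (2 * s ^+ 2))).
      by apply: cvgM; [exact: cvg_cst|exact: cvg_mul_normal_pdf].
    by apply/funext => x; rewrite normal_pdf0N//; ring.
rewrite RintegralB// => /eqP; rewrite subr_eq0 => /eqP ->.
rewrite RintegralZl//; last exact: integrable_normal_pdf.
by rewrite /Rintegral integral_normal_pdf/= mulr1.
Qed.

Lemma centered_moments_normal s : 0 < s ->
  centered_moments (normal_prob 0 s) (s ^+ 2) (64 * s ^+ 3).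
Proof.
move=> s0; split; [exact: normal_mean|exact: normal_variance|].
exact: integral_cube_normal_le.
Qed.

End normal_moments.

Section normal_convolution.
Context (R : realType).
Local Notation mR := (measurableTypeR R).
Local Notation leb := (@lebesgue_measure R).
Implicit Types (a b c s x y z : R).

Definition centered_normal s : probability mR R := normal_prob 0 s.

Lemma normal_peakM a b c d : 0 < a -> 0 < b -> 0 < c -> 0 < d ->
  a * b = c * d ->
  normal_peak a * normal_peak b = normal_peak c * normal_peak d :> R.
Proof.
move=> a0 b0 c0 d0 abcd.
have peakE s : 0 < s -> normal_peak s = normal_peak 1 / s.
  by move=> s0; rewrite -[in LHS](mulr1 s) normal_peakZ.
by rewrite (peakE a)// (peakE b)// (peakE c)// (peakE d)// !mulf_div abcd.
Qed.

Lemma normal_pdfM_split a b c x y : 0 < a -> 0 < b -> 0 < c ->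
  c ^+ 2 = a ^+ 2 + b ^+ 2 ->
  normal_pdf 0 b (x - y) * normal_pdf 0 a y =
  normal_pdf 0 c x * normal_pdf (x * a ^+ 2 / c ^+ 2) (a * b / c) y.
Proof.
move=> a0 b0 c0 cab; have d0 : 0 < a * b / c by rewrite divr_gt0// mulr_gt0.
have [an bn cn dn] : [/\ a != 0, b != 0, c != 0 & a * b / c != 0].
  by rewrite !gt_eqF.
rewrite !normal_pdfE// mulrACA [RHS]mulrACA; congr (_ * _).
  by apply: normal_peakM => //; rewrite mulrC mulrCA divff// mulr1.
rewrite /normal_fun -!expRD !subr0; congr expR.
have ab0 : a ^+ 2 + b ^+ 2 != 0 by rewrite -cab expf_neq0.
rewrite !exprMn exprVn cab; field.
by rewrite ab0 an bn.
Qed.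

Local Open Scope ereal_scope.

Let mpdf m s : measurable_fun setT (fun y : R => (normal_pdf m s y)%:E).
Proof. by apply/measurable_EFinP; exact: measurable_normal_pdf. Qed.

Let pdf0 m s x : 0 <= (normal_pdf m s x)%:E.
Proof. by rewrite lee_fin normal_pdf_ge0. Qed.

Lemma normal_pdf_convolution a b c x : (0 < a)%R -> (0 < b)%R -> (0 < c)%R ->
  (c ^+ 2 = a ^+ 2 + b ^+ 2)%R ->
  \int[leb]_y ((normal_pdf 0 b (x - y))%:E * (normal_pdf 0 a y)%:E) =
  (normal_pdf 0 c x)%:E.
Proof.
move=> a0 b0 c0 cab.
under eq_integral do rewrite -EFinM (normal_pdfM_split _ _ a0 b0 c0 cab) EFinM.
rewrite ge0_integralZl//; last exact: mpdf.
by rewrite integral_normal_pdf mule1.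
Qed.

Lemma average_normal_shift s (f : R -> \bar R) y : ge0_measurable f ->
  average (centered_normal s) f y =
  \int[leb]_z (f z * (normal_pdf 0 s (z - y))%:E).
Proof.
move=> gmf; have [mfy _] := ge0_measurable_shift y gmf; have [mf f0] := gmf.
have gm_shifted : ge0_measurable (fun z => f z * (normal_pdf 0 s (z - y))%:E).
  split=> [|z]; last exact: mule_ge0.
  apply: emeasurable_funM => //.
  by apply: (measurableT_comp (mpdf 0 s)); exact: measurable_funB.
rewrite (lebesgue_integral_affine y ltr01 measurableT gm_shifted).
rewrite mul1e preimage_setT.
rewrite /average (integral_normal_prob 0 s mfy).
by apply: eq_integral => z _; rewrite mul1r addrK addrC.
Qed.

Lemma average_normal_convolution a b c (f : R -> \bar R) :
  (0 < a)%R -> (0 < b)%R -> (0 < c)%R ->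
  (c ^+ 2 = a ^+ 2 + b ^+ 2)%R -> ge0_measurable f ->
  average (centered_normal a) (average (centered_normal b) f) =
  average (centered_normal c) f.
Proof.
move=> a0 b0 c0 cab gmf; apply/funext => x.
have gmfx := ge0_measurable_shift x gmf; have [mfx fx0] := gmfx.
have [mavg avg0] := ge0_measurable_shift x
  (ge0_measurable_average (centered_normal b) gmf).
pose k (z : mR * mR) : \bar R := f (x + z.2)%R *
  ((normal_pdf 0 b (z.2 - z.1))%:E * (normal_pdf 0 a z.1)%:E).
have mk : measurable_fun setT k.
  apply: emeasurable_funM; first by apply: (measurableT_comp mfx).
  apply: emeasurable_funM; last exact: (measurableT_comp (mpdf 0 a)).
  by apply: (measurableT_comp (mpdf 0 b)); exact: measurable_funB.
have k0 (z : mR * mR) : 0 <= k z by rewrite /k !mule_ge0.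
transitivity (\int[leb]_y \int[leb]_w k (y, w)).
  rewrite {1}/average (integral_normal_prob 0 a mavg); apply: eq_integral => y _.
  have -> : average (centered_normal b) f (x + y)%R =
      average (centered_normal b) (fun w => f (x + w)%R) y.
    by rewrite /average; under eq_integral do rewrite -addrA.
  rewrite average_normal_shift// -ge0_integralZr//.
  - by apply: eq_integral => w _; rewrite /k/= muleA.
  - apply: emeasurable_funM => //.
    by apply: (measurableT_comp (mpdf 0 b)); exact: measurable_funB.
  - by move=> w _; exact: mule_ge0.
rewrite (@fubini_tonelli _ _ _ _ _ leb leb _ mk k0) /average.
rewrite (integral_normal_prob 0 c mfx).
apply: eq_integral => w _; rewrite /k/= ge0_integralZl//.
- by rewrite (normal_pdf_convolution w a0 b0 c0 cab).
- apply: emeasurable_funM; last exact: mpdf.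
  by apply: (measurableT_comp (mpdf 0 b)); exact: measurable_funB.
- by move=> y _; exact: mule_ge0.
Qed.

Lemma averages_normal (I : eqType) (s : seq I) (sigma : I -> R) (f : R -> \bar R) :
  ge0_measurable f -> (0 < size s)%N -> (forall i, i \in s -> (0 < sigma i)%R) ->
  averages [seq centered_normal (sigma i) | i <- s] f =
  average (centered_normal (Num.sqrt (\sum_(i <- s) sigma i ^+ 2))) f.
Proof.
move=> gmf; elim: s => [//|i [_ _ sigma0|j s IH _ sigma0]].
  by rewrite big_seq1 sqrtr_sqr gtr0_norm// sigma0// mem_head.
have tail k : k \in j :: s -> (0 < sigma k)%R.
  by move=> ks; apply: sigma0; rewrite in_cons ks orbT.
have si0 : (0 < sigma i)%R by apply: sigma0; exact: mem_head.
have sum0 : (0 < \sum_(k <- j :: s) sigma k ^+ 2)%R.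
  rewrite big_cons; apply: ltr_pwDl; first exact/exprn_gt0/tail/mem_head.
  by apply: sumr_ge0 => k _; exact: sqr_ge0.
have sum_cons0 : (0 < \sum_(k <- i :: j :: s) sigma k ^+ 2)%R.
  by rewrite big_cons; apply: ltr_wpDl; first exact: sqr_ge0.
apply: etrans (congr1 (average (centered_normal (sigma i))) (IH isT tail)) _.
apply: average_normal_convolution.
- exact: si0.
- by rewrite sqrtr_gt0.
- by rewrite sqrtr_gt0.
- by rewrite (sqr_sqrtr (ltW sum0)) (sqr_sqrtr (ltW sum_cons0)) big_cons.
- exact: gmf.
Qed.

End normal_convolution.

Section lindeberg.
Context (R : realType).
Implicit Types (s : seq R) (a h m x : R).

Lemma std_normal_integral (f : R -> \bar R) :
  (\int[std_normal R]_x f x = average (centered_normal 1) f 0)%E.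
Proof.
transitivity (\int[centered_normal 1]_x f x)%E.
  by apply: eq_measure_integral => A mA _; exact: law_ofE.
by apply: eq_integral => x _; rewrite add0r.
Qed.

Lemma sum_third_moments_le s m : (forall x, x \in s -> 0 < x <= m) ->
  \sum_(x <- s) (x ^+ 3 + 64 * (x / Num.sqrt 12) ^+ 3) <=
  65 * m * \sum_(x <- s) x ^+ 2.
Proof.
move=> sm; rewrite mulr_sumr !big_seq; apply: ler_sum => x /sm/andP[x0 xm].
have scaled_le : (x / Num.sqrt 12) ^+ 3 <= x ^+ 3.
  rewrite lerXn2r ?nnegrE ?divr_ge0 ?(ltW x0)// ler_pdivrMr ?sqrtr_gt0//.
  by rewrite ler_peMr ?(ltW x0)// -{1}sqrtr1 ler_sqrt// ler1n.
have cube_le : x ^+ 3 <= m * x ^+ 2 by rewrite exprS ler_wpM2r ?sqr_ge0.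
by rewrite -mulrA; lra.
Qed.

(* The normal summands have the variances [x ^+ 2 / 12] of the uniform ones,
   which add up to 1. *)
Lemma lindeberg_uniform s m a h : 0 < h -> (forall x, x \in s -> 0 < x <= m) ->
  \sum_(x <- s) x ^+ 2 = 12 ->
  let unif := averages [seq centered_uniform x | x <- s] (EFin \o step a h) 0 in
  let norm := (\int[std_normal R]_x (step a h x)%:E)%E in
  (unif <= norm + (130 * m / h ^+ 3)%:E /\
   norm <= unif + (130 * m / h ^+ 3)%:E)%E.
Proof.
move=> h0 sm s12 unif norm; pose sigma x : R := x / Num.sqrt 12.
have sqrt12 : 0 < Num.sqrt 12 :> R by rewrite sqrtr_gt0.
have s0 x : x \in s -> 0 < x by move=> /sm/andP[].
have sigma0 x : x \in s -> 0 < sigma x by move=> /s0 x0; rewrite divr_gt0.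
have sigma2 x : sigma x ^+ 2 = x ^+ 2 / 12 by rewrite expr_div_n sqr_sqrtr.
have normE : norm = averages [seq centered_normal (sigma x) | x <- s]
    (EFin \o step a h) 0.
  rewrite averages_normal//; last 2 first.
  - exact: ge0_measurable_step.
  - by case: (s) s12 => //; rewrite big_nil => /eqP; rewrite lt_eqF.
  under eq_bigr do rewrite sigma2.
  by rewrite -mulr_suml s12 divff// sqrtr1 -std_normal_integral.
have mom_unif x : x \in s ->
    centered_moments (centered_uniform x) (x ^+ 2 / 12) (x ^+ 3).
  by move=> /s0; exact: centered_moments_uniform.
have mom_norm x : x \in s ->
    centered_moments (centered_normal (sigma x)) (x ^+ 2 / 12) (64 * sigma x ^+ 3).
  by move=> /sigma0; rewrite -sigma2; exact: centered_moments_normal.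
have error_le : h ^- 3 / 6 * \sum_(x <- s) (x ^+ 3 + 64 * sigma x ^+ 3) <=
    130 * m / h ^+ 3.
  have := sum_third_moments_le sm; rewrite s12.
  have coef_ge0 : 0 <= h ^- 3 / 6 by rewrite divr_ge0// invr_ge0 exprn_ge0// ltW.
  move=> /(ler_wpM2l coef_ge0)/le_trans; apply; rewrite le_eqVlt; apply/orP; left.
  by apply/eqP; field; rewrite gt_eqF.
have exchange := lindeberg_replacement
  (fun k x => is_derive_step_deriv a h k x) (fun x => norm_step_deriv3_le a x h0).
have step_deriv_ge0 y : 0 <= step_deriv a h 0 y by rewrite step_deriv0 step_ge0.
rewrite normE /unif -(step_deriv0 a h); split.
  apply: (le_trans (exchange _ _ _ _ _ _ _ _ step_deriv_ge0 mom_unif mom_norm)).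
  by rewrite leeD2l// lee_fin.
apply: (le_trans (exchange _ _ _ _ _ _ _ _ step_deriv_ge0 mom_norm mom_unif)).
by rewrite leeD2l// lee_fin; under eq_bigr do rewrite addrC.
Qed.

End lindeberg.

Section decreasing_sort.
Context (disp : Order.disp_t) (T : orderType disp).
Implicit Types (s : seq T) (x : T) (i j k : nat).
Local Open Scope order_scope.

Lemma sorted_ge_nth x0 s i j : sorted >=%O s -> (i <= j)%N -> (j < size s)%N ->
  nth x0 s j <= nth x0 s i.
Proof.
move=> s_sorted ij js.
apply: (@sorted_leq_nth _ (>=%O : rel T) _ _ x0 s s_sorted i j) => //.
- by move=> y x z xy yz; exact: le_trans yz xy.
- by move=> y; exact: lexx.
- by rewrite inE (leq_ltn_trans ij).
Qed.

Lemma sort_ge_sorted s : sorted >=%O (sort >=%O s).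
Proof. by apply: sort_sorted => y z; exact: le_total. Qed.

Lemma le_nth_sort_ge x0 s k x : (k < size s)%N ->
  (x <= nth x0 (sort >=%O s) k) = (k < count (>= x) s)%N.
Proof.
move=> ks; have sort_sorted := @sort_ge_sorted s.
have countE : count (>= x) (sort >=%O s) = count (>= x) s.
  by apply/permP; rewrite perm_sort.
have [k_lt|k_ge] := ltnP k (count (>= x) s).
- apply: (@nth_count_le _ T^d x x0 _ k sort_sorted).
  by rewrite -[X in (_ < X)%N]countE in k_lt.
- apply/negbTE; rewrite -ltNge.
  apply: (@nth_count_gt _ T^d x x0 _ k sort_sorted).
  by rewrite size_sort ks andbT -[X in (X <= _)%N]countE in k_ge *.
Qed.

End decreasing_sort.

Section near_sequences.
Context (T : Type) (F : set_system T) {FF : Filter F}.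

Lemma near_all_in (I : choiceType) (l : seq I) (P : I -> T -> Prop) :
  (forall i, i \in l -> \forall y \near F, P i y) ->
  \forall y \near F, forall i, i \in l -> P i y.
Proof.
move=> nearP; apply: filterS (@filter_bigI T I [fset i in l]%fset P F FF _).
  by move=> y Py i il; apply: Py; rewrite /= inE.
by move=> i; rewrite inE; exact: nearP.
Qed.

End near_sequences.

Section multiset_sequences.
Context (R : realType).
Implicit Types (s : seq R) (u : nat -> R) (x e : R) (k n : nat).

Lemma multiset_seq_vanishes s : vanishes_from (size s) (multiset_seq s).
Proof. by move=> k sk; rewrite /multiset_seq nth_default// size_sort. Qed.

Lemma multiset_seq_ind (P : R -> Prop) s k : P 0 -> (forall x, x \in s -> P x) ->
  P (multiset_seq s k).
Proof.
move=> P0 Ps; have [ks|ks] := ltnP k (size s).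
  by apply: Ps; rewrite -(mem_sort >=%R) mem_nth// size_sort.
by rewrite multiset_seq_vanishes.
Qed.

Lemma multiset_seq_ge0 s k : (forall x, x \in s -> 0 <= x) -> 0 <= multiset_seq s k.
Proof. by move=> s0; exact: (multiset_seq_ind (P := fun x => 0 <= x)). Qed.

Lemma multiset_seq_nonincreasing s i j : (forall x, x \in s -> 0 <= x) ->
  (i <= j)%N -> multiset_seq s j <= multiset_seq s i.
Proof.
move=> s0 ij; have [js|js] := ltnP j (size s); last first.
  by rewrite (multiset_seq_vanishes js) multiset_seq_ge0.
by apply: sorted_ge_nth; rewrite ?size_sort//; exact: sort_ge_sorted.
Qed.

Lemma multiset_seq_sumsq s :
  \sum_(0 <= k < size s) multiset_seq s k ^+ 2 = \sum_(x <- s) x ^+ 2.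
Proof.
rewrite [RHS](perm_big (sort >=%R s)) /=; last by rewrite perm_sym perm_sort.
by rewrite [RHS](big_nth 0) size_sort.
Qed.

Lemma multiset_seq_map_le (I : eqType) (l : seq I) (f g : I -> R) e k :
  (k < size l)%N -> (forall i, i \in l -> f i <= g i + e) ->
  multiset_seq (map f l) k <= multiset_seq (map g l) k + e.
Proof.
move=> kl fg; rewrite -lerBlDr le_nth_sort_ge ?size_map// count_map.
set x := multiset_seq _ _.
have : (k < count (>= x) (map f l))%N by rewrite -(le_nth_sort_ge 0) ?size_map.
rewrite count_map => /leq_trans; apply.
rewrite (@eq_in_count _ _ (predI (preim f (>= x)) (mem l))); last first.
  by move=> i il /=; rewrite il andbT.
apply: sub_count => i /= /andP[xi il].
by rewrite lerBlDr (le_trans xi)// fg.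
Qed.

Lemma dist_multiset_seq_map (I : eqType) (l : seq I) (f g : I -> R) e k :
  0 <= e -> (forall i, i \in l -> `|f i - g i| <= e) ->
  `|multiset_seq (map f l) k - multiset_seq (map g l) k| <= e.
Proof.
move=> e0 fg; have [lk|kl] := leqP (size l) k.
  by rewrite !multiset_seq_vanishes ?size_map// subrr normr0.
have fg_le : multiset_seq (map f l) k <= multiset_seq (map g l) k + e.
  apply: multiset_seq_map_le => // i il; rewrite -lerBlDl.
  exact: le_trans (ler_norm _) (fg i il).
have gf_le : multiset_seq (map g l) k <= multiset_seq (map f l) k + e.
  apply: multiset_seq_map_le => // i il; rewrite -lerBlDl.
  by apply: le_trans (ler_norm _) _; rewrite distrC fg.
by rewrite ler_norml; apply/andP; split; lra.
Qed.

Lemma l2norm_vanishes u n : vanishes_from n u ->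
  l2norm u = Num.sqrt (\sum_(0 <= k < n) u k ^+ 2).
Proof.
move=> u0; rewrite /l2norm; congr Num.sqrt; apply/cvg_lim => //.
by apply: cvg_sum_vanishes_from => k /u0 ->; rewrite expr0n.
Qed.

Lemma l2norm_multiset_seq s :
  l2norm (multiset_seq s) = Num.sqrt (\sum_(x <- s) x ^+ 2).
Proof.
by rewrite (l2norm_vanishes (@multiset_seq_vanishes s)) multiset_seq_sumsq.
Qed.

Lemma hat_multiset_seq_sqr s k : 0 < \sum_(x <- s) x ^+ 2 ->
  hat (multiset_seq s) k ^+ 2 = 12 / (\sum_(x <- s) x ^+ 2) * multiset_seq s k ^+ 2.
Proof.
move=> s0; rewrite /hat l2norm_multiset_seq expr_div_n exprMn.
by rewrite !sqr_sqrtr ?(ltW s0)// mulrAC.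
Qed.

(* The variance of [U[-t/2, t/2]] is [t ^+ 2 / 12]. *)
Definition normalized n u :=
  [/\ vanishes_from n u, forall k, 0 <= u k,
      forall i j, (i <= j)%N -> u j <= u i &
      \sum_(0 <= k < n) u k ^+ 2 = 12].

Lemma hat_multiset_seq_normalized s : (forall x, x \in s -> 0 <= x) ->
  0 < \sum_(x <- s) x ^+ 2 -> normalized (size s) (hat (multiset_seq s)).
Proof.
move=> s0 sumsq0; have scale0 : 0 <= Num.sqrt 12 / l2norm (multiset_seq s).
  by rewrite divr_ge0 ?sqrtr_ge0.
have hatE k : hat (multiset_seq s) k =
    Num.sqrt 12 / l2norm (multiset_seq s) * multiset_seq s k.
  by rewrite /hat mulrAC.
split.
- by move=> k sk; rewrite hatE multiset_seq_vanishes// mulr0.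
- by move=> k; rewrite hatE mulr_ge0// multiset_seq_ge0.
- by move=> i j ij; rewrite !hatE ler_wpM2l// multiset_seq_nonincreasing.
- under eq_bigr do rewrite hat_multiset_seq_sqr//.
  by rewrite -mulr_sumr multiset_seq_sumsq divfK// gt_eqF.
Qed.

Definition positive_multiset n u :=
  [/\ vanishes_from n u, forall k, (k < n)%N -> 0 < u k &
      forall i j, (i <= j)%N -> u j <= u i].

Lemma normalized_positive_multiset n u : normalized n u ->
  exists2 m, positive_multiset m u & \sum_(0 <= k < m) u k ^+ 2 = 12.
Proof.
move=> [un u_ge0 u_dec u12].
have ex0 : exists k, u k == 0 by exists n; rewrite un.
case: (ex_minnP ex0) => m /eqP um m_min.
have um0 : vanishes_from m u.
  by move=> k mk; apply/eqP; rewrite eq_le u_ge0 -um u_dec.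
exists m.
  split=> // k km; rewrite lt_neqAle u_ge0 andbT eq_sym.
  by apply: contraTneq km => /eqP/m_min; rewrite leqNgt.
rewrite -u12; apply/esym/sum_vanishes_from; last by apply: m_min; rewrite un.
by move=> k /um0 ->; rewrite expr0n.
Qed.

End multiset_sequences.

Section multiset_continuity.
Context (R : realType) (T : topologicalType) (I : choiceType) (l : seq I).
Context (f : I -> T -> R).
Hypothesis cf : forall i, continuous (f i).
Implicit Types (x : T) (k : nat).

Lemma continuous_multiset_seq_map k :
  continuous (fun x => multiset_seq [seq f i x | i <- l] k).
Proof.
move=> x; apply/cvgrPdist_le => e e0.
have : \forall y \near x, forall i, i \in l -> `|f i x - f i y| <= e.
  by apply: near_all_in => i _; have /cvgrPdist_le := @cf i x; exact.
apply: filterS => y; apply: dist_multiset_seq_map; exact: ltW.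
Qed.

Lemma continuous_sumsq : continuous (fun x => \sum_(i <- l) f i x ^+ 2).
Proof.
apply: continuous_big; first exact: add_continuous.
move=> i _ x; apply: (@continuous_comp _ _ _ (f i) (fun z => z ^+ 2)).
  exact: cf.
exact: exprn_continuous.
Qed.

Lemma hat_multiset_seq_map_continuous k x : 0 < \sum_(i <- l) f i x ^+ 2 ->
  {for x, continuous (fun y => hat (multiset_seq [seq f i y | i <- l]) k)}.
Proof.
move=> sumsq0; have normE y : l2norm (multiset_seq [seq f i y | i <- l]) =
    Num.sqrt (\sum_(i <- l) f i y ^+ 2).
  by rewrite l2norm_multiset_seq big_map.
rewrite /hat; apply: cvgM.
  by apply: cvgM; [exact: cvg_cst|exact: continuous_multiset_seq_map].
apply: cvgV; first by rewrite normE gt_eqF// sqrtr_gt0.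
under eq_fun do rewrite normE; rewrite normE.
apply: (@continuous_comp _ _ _ (fun y => \sum_(i <- l) f i y ^+ 2) Num.sqrt).
  exact: continuous_sumsq.
exact: sqrt_continuous.
Qed.

End multiset_continuity.

Section distances.
Context (R : realType).
Implicit Types (t : seq R) (u : nat -> R) (m : nat).

Definition index_pairs m : seq (nat * nat) :=
  [seq (i, j) | j <- iota 0 m, i <- iota 0 j].

Lemma mem_index_pairs m p : p \in index_pairs m -> (p.1 < p.2)%N /\ (p.2 < m)%N.
Proof.
move=> /allpairsPdep[j [i [+ + ->]]] /=.
by rewrite !mem_iota !add0n.
Qed.

Lemma sum_index_pairs m (F : nat * nat -> R) :
  \sum_(p <- index_pairs m) F p = \sum_(0 <= j < m) \sum_(0 <= i < j) F (i, j).
Proof.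
rewrite big_allpairs_dep /index_iota subn0; apply: eq_bigr => j _.
by rewrite subn0.
Qed.

Definition distances t : seq R :=
  [seq t`_p.1 - t`_p.2 | p <- index_pairs (size t)].

Lemma distance_multisetE t : distance_multiset t = multiset_seq (distances t).
Proof. by rewrite /distance_multiset /distances /index_pairs map_allpairs. Qed.

Lemma distances_mkseq u m :
  distances (mkseq u m) = [seq u p.1 - u p.2 | p <- index_pairs m].
Proof.
rewrite /distances size_mkseq; apply/eq_in_map => p /mem_index_pairs[p12 p2].
by rewrite !nth_mkseq//; exact: ltn_trans p2.
Qed.

Lemma unit_span_size_gt0 t : unit_span_multiset t -> (0 < size t)%N.
Proof. by move=> [t2 _ _ _]; exact: ltn_trans t2. Qed.

Lemma unit_span_itv t k : unit_span_multiset t -> 0 <= t`_k <= 1.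
Proof.
move=> ut; have t_gt0 := unit_span_size_gt0 ut; have [_ t_sorted t0 t_last] := ut.
have [kt|kt] := ltnP k (size t); last by rewrite nth_default// lexx ler01.
apply/andP; split; last by rewrite -[leRHS]t0 (sorted_ge_nth _ t_sorted).
rewrite -[leLHS]t_last (sorted_ge_nth _ t_sorted) ?prednK//.
by rewrite -ltnS prednK.
Qed.

Lemma distances_itv t x : unit_span_multiset t -> x \in distances t -> 0 <= x <= 1.
Proof.
move=> ut /mapP[[i j] /mem_index_pairs[/= ij jt] ->].
have [_ t_sorted _ _] := ut.
have /andP[ti0 ti1] := unit_span_itv i ut; have /andP[tj0 _] := unit_span_itv j ut.
rewrite subr_ge0 (sorted_ge_nth _ t_sorted) ?(ltnW ij)//=; lra.
Qed.

(* The pairs containing the end point 1 contribute [(1 - t_k)^2], those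
   containing the end point 0 contribute [t_k^2]. *)
Lemma distances_sumsq_ge t : unit_span_multiset t ->
  (size t)%:R / 4 <= \sum_(x <- distances t) x ^+ 2.
Proof.
move=> ut; have m0 := unit_span_size_gt0 ut; have [_ _ t0 t_last] := ut.
rewrite big_map sum_index_pairs; set m := size t in m0 t_last *.
pose col j := \sum_(0 <= i < j) (t`_i - t`_j) ^+ 2.
rewrite (_ : \sum_(0 <= j < m) _ = \sum_(0 <= j < m) col j)//.
have col_ge0 j : 0 <= col j by apply: sumr_ge0 => i _; exact: sqr_ge0.
have sum_to1 : \sum_(0 <= j < m) (1 - t`_j) ^+ 2 <= \sum_(0 <= j < m) col j.
  apply: ler_sum => -[|j] _; first by rewrite t0 subrr expr0n col_ge0.
  rewrite /col big_nat_recl// t0 lerDl.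
  by apply: sumr_ge0 => i _; exact: sqr_ge0.
have sum_to0 : \sum_(0 <= j < m) t`_j ^+ 2 <= \sum_(0 <= j < m) col j.
  rewrite -(prednK m0) big_nat_recr//= [leRHS]big_nat_recr//= t_last expr0n addr0.
  rewrite -[leLHS]add0r lerD//; first by apply: sumr_ge0.
  by rewrite /col; apply: ler_sum => i _; rewrite t_last subr0.
have half_sum : m%:R / 2 <= \sum_(0 <= j < m) ((1 - t`_j) ^+ 2 + t`_j ^+ 2).
  have -> : m%:R / 2 = \sum_(0 <= j < m) (2^-1 : R).
    by rewrite sumr_const_nat subn0 mulr_natl.
  by apply: ler_sum => j _; have := sqr_ge0 (t`_j - 2^-1); nra.
by rewrite big_split/= in half_sum; move: sum_to1 sum_to0 half_sum; lra.
Qed.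

Lemma distances_sumsq_gt0 t : unit_span_multiset t ->
  0 < \sum_(x <- distances t) x ^+ 2.
Proof.
move=> ut; apply: lt_le_trans (distances_sumsq_ge ut).
by rewrite divr_gt0// ltr0n unit_span_size_gt0.
Qed.

Lemma hat_distance_normalized t : unit_span_multiset t ->
  normalized (size (index_pairs (size t))) (hat (distance_multiset t)).
Proof.
move=> ut; rewrite distance_multisetE.
have := @hat_multiset_seq_normalized _ (distances t); rewrite size_map; apply.
  by move=> x /(distances_itv ut)/andP[].
exact: distances_sumsq_gt0.
Qed.

Lemma hat_distance_sqr_le t k : unit_span_multiset t ->
  hat (distance_multiset t) k ^+ 2 <= 48 / (size t)%:R.
Proof.
move=> ut; have sumsq_gt0 := distances_sumsq_gt0 ut.
have t0 : 0 < (size t)%:R :> R by rewrite ltr0n unit_span_size_gt0.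
rewrite distance_multisetE hat_multiset_seq_sqr//.
have /andP[d0 d1] : 0 <= multiset_seq (distances t) k <= 1.
  apply: (multiset_seq_ind (P := fun x => 0 <= x <= 1)) => [|x].
    by rewrite lexx ler01.
  exact: distances_itv.
apply: (@le_trans _ _ (12 / (\sum_(x <- distances t) x ^+ 2))).
  by rewrite ler_piMr ?exprn_ile1// divr_ge0// ltW.
rewrite ler_pdivrMr// mulrAC ler_pdivlMr//.
by have := distances_sumsq_ge ut; lra.
Qed.

Lemma P_DIST_positive_multiset (u : {ptws nat -> R}) : P_DIST R u ->
  exists2 n, positive_multiset n u & \sum_(0 <= k < n) u k ^+ 2 = 12.
Proof.
by move=> [t /hat_distance_normalized + <-]; exact: normalized_positive_multiset.
Qed.

Lemma P_DIST_gt0 (u : {ptws nat -> R}) : P_DIST R u -> 0 < u 0%N.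
Proof.
move=> /P_DIST_positive_multiset[[|n] [_ u_gt0 _] u12]; last exact: u_gt0.
by move: u12; rewrite big_nil => /eqP; rewrite eq_sym pnatr_eq0.
Qed.

Lemma P_DIST_neq0 (u : {ptws nat -> R}) : P_DIST R u -> u <> (fun=> 0).
Proof. by move=> /P_DIST_gt0 u_gt0 u0; rewrite u0 ltxx in u_gt0. Qed.

End distances.

Section pointwise_topology.
Context (R : realType).
Local Notation S := {ptws nat -> R}.
Implicit Types (u : S) (k : nat) (a b : R).

Lemma coord_continuous k : continuous (fun u : S => u k).
Proof. exact: (@proj_continuous nat (fun=> R) k). Qed.

Lemma continuous_coordB (i j : nat) : continuous (fun u : S => u i - u j).
Proof.
move=> u; exact: (@continuousB R R S (fun u => u i) (fun u => u j) u
  (@coord_continuous i u) (@coord_continuous j u)).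
Qed.

Lemma ptws_hausdorff : hausdorff_space S.
Proof. by apply: hausdorff_product => k; exact: norm_hausdorff. Qed.

Lemma ptws_continuous_at (T : topologicalType) (f : T -> S) (x : T) :
  (forall k, {for x, continuous (fun y => f y k)}) -> {for x, continuous f}.
Proof.
by move=> cf; apply/(@pointwise_cvgP nat R (f @ x) (f x) _) => k; exact: cf.
Qed.

Definition cube a b : set S := [set u | forall k, `[a, b]%classic (u k)].

Lemma cube_compact a b : compact (cube a b).
Proof.
apply: (@tychonoff nat (fun=> R) (fun=> `[a, b]%classic)) => k.
exact: segment_compact.
Qed.

Lemma closed_cube a b : closed (cube a b).
Proof. by apply: compact_closed; [exact: ptws_hausdorff|exact: cube_compact]. Qed.

Lemma closed_coord_eq k a : closed [set u : S | u k = a].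
Proof.
apply: (@preimage_closed S R (fun u => u k) [set x | x = a]).
  by move=> u _; exact: coord_continuous.
exact: closed_eq.
Qed.

Lemma closed_coord_le (i j : nat) : closed [set u : S | u j <= u i].
Proof.
rewrite (_ : mkset _ = [set u : S | 0 <= u i - u j]); last first.
  by apply/seteqP; split => u /=; rewrite subr_ge0.
apply: (@preimage_closed S R (fun u => u i - u j) [set x | 0 <= x]).
  by move=> u _; exact: continuous_coordB.
exact: closed_ge.
Qed.

End pointwise_topology.

Section closure_P_DIST.
Context (R : realType).
Local Notation S := {ptws nat -> R}.
Implicit Types (u v : S) (k m N : nat).

Definition P_DIST_size m : set S :=
  [set hat (distance_multiset t) | t in
    [set t | unit_span_multiset t /\ size t = m]].

Lemma P_DISTE : P_DIST R = \bigcup_m P_DIST_size m.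
Proof.
apply/seteqP; split => u [].
  by move=> t ut <-; exists (size t) => //; exists t.
by move=> m _ [t [ut _] <-]; exists t.
Qed.

Lemma P_DIST_size_sqr_le u m k : P_DIST_size m u -> u k ^+ 2 <= 48 / m%:R.
Proof. by move=> [t [ut <-] <-]; exact: hat_distance_sqr_le. Qed.

Lemma P_DIST_size_normalized u m : P_DIST_size m u ->
  normalized (size (index_pairs m)) u.
Proof. by move=> [t [ut <-] <-]; exact: hat_distance_normalized. Qed.

Definition span_cube m : set S :=
  cube 0 1 `&` [set u | unit_span_multiset (mkseq u m)].

Lemma unit_span_mkseqE m : (1 < m)%N ->
  [set u : S | unit_span_multiset (mkseq u m)] =
  [set u | u 0%N = 1] `&` [set u | u m.-1 = 0] `&`
  \bigcap_(i in [set i | (i.+1 < m)%N]) [set u | u i.+1 <= u i].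
Proof.
move=> m1; have m0 : (0 < m)%N by exact: ltn_trans m1.
apply/seteqP; split => u /=.
- move=> [_ u_sorted]; rewrite size_mkseq !nth_mkseq ?prednK// => u0 ulast.
  split=> // i /= im; have := @sorted_ge_nth _ _ 0 _ i i.+1 u_sorted (leqnSn i).
  by rewrite size_mkseq !nth_mkseq ?(ltnW im)//; exact.
- move=> [[u0 ulast] u_dec]; split; rewrite ?size_mkseq ?nth_mkseq ?prednK//.
  apply/(sortedP 0) => i; rewrite size_mkseq => im.
  by rewrite !nth_mkseq ?(ltnW im)//; exact: u_dec.
Qed.

Lemma span_cube_compact m : compact (span_cube m).
Proof.
have [m1|m1] := leqP m 1.
  rewrite (_ : span_cube m = set0); first exact: compact0.
  by apply/seteqP; split => // u [_ []]; rewrite size_mkseq leqNgt ltnS m1.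
apply: (subclosed_compact _ (@cube_compact R 0 1)); last by move=> u [].
rewrite /span_cube unit_span_mkseqE//; apply: closedI; first exact: closed_cube.
apply: closedI; first by apply: closedI; exact: closed_coord_eq.
by apply: closed_bigI => i _; exact: closed_coord_le.
Qed.

Definition hat_span m u : S := hat (distance_multiset (mkseq u m)).

Lemma hat_span_continuous m u : unit_span_multiset (mkseq u m) ->
  {for u, continuous (hat_span m)}.
Proof.
move=> um; apply: ptws_continuous_at => k.
rewrite (_ : (fun v => _) = (fun v : S =>
    hat (multiset_seq [seq v p.1 - v p.2 | p <- index_pairs m]) k)); last first.
  by apply/funext => v; rewrite /hat_span distance_multisetE distances_mkseq.
apply: (@hat_multiset_seq_map_continuous R S _ (index_pairs m)
  (fun p v => v p.1 - v p.2)).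
  by move=> p; exact: continuous_coordB.
by have := distances_sumsq_gt0 um; rewrite distances_mkseq big_map.
Qed.

Lemma P_DIST_size_image m : P_DIST_size m = hat_span m @` span_cube m.
Proof.
apply/seteqP; split => [_ [t [ut tm] <-]|_ [u [_ um] <-]]; last first.
  by exists (mkseq u m) => //; split => //; rewrite size_mkseq.
have tE : mkseq (nth 0 t) m = t by rewrite -tm mkseq_nth.
exists (nth 0 t); last by rewrite /hat_span tE.
by split=> [k|] /=; [rewrite in_itv/= unit_span_itv|rewrite tE].
Qed.

Lemma P_DIST_size_compact m : compact (P_DIST_size m).
Proof.
rewrite P_DIST_size_image; apply: continuous_compact; last exact: span_cube_compact.
apply: continuous_in_subspaceT => u; rewrite inE => -[_].
exact: hat_span_continuous.
Qed.

(* A lower bound on one coordinate bounds the number of points of nearby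
   multisets, and finitely many sizes form a closed set. *)
Lemma closure_P_DIST_size v k (c : R) N : closure (P_DIST R) v -> 0 < c ->
  c < v k ^+ 2 -> 48 / c < N%:R -> exists2 m, (m < N)%N & P_DIST_size m v.
Proof.
move=> Pv c0 cv cN.
pose U : set S := \bigcup_(m in [set` iota 0 N]) P_DIST_size m.
have U_closed : closed U.
  rewrite /U bigcup_seq; apply: compact_closed; first exact: ptws_hausdorff.
  by apply: bigsetU_compact => m _; exact: P_DIST_size_compact.
suff : closure U v.
  rewrite -(closure_id _).1// => -[m /=].
  by rewrite mem_iota => /andP[_ mN] Pm; exists m.
move=> B Bv; have near_c : nbhs v [set w : S | c < w k ^+ 2].
  have csqr := @continuous_comp S R R (fun w => w k) (fun z => z ^+ 2) v
    (@coord_continuous R k v) (@exprn_continuous R 2 (v k)).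
  apply: (csqr [set z | c < z]); apply: open_nbhs_nbhs.
  by split; [exact: open_gt|exact: cv].
have [w [Pw [Bw /= cw]]] := Pv _ (filterI Bv near_c).
exists w; split => //; move: Pw; rewrite P_DISTE => -[m _ Pmw].
exists m => //=; rewrite mem_iota/= add0n -(ltr_nat R); apply: lt_trans cN.
have m0 : 0 < m%:R :> R.
  by rewrite ltr0n; have [t [/unit_span_size_gt0 + <-] _] := Pmw.
rewrite ltr_pdivlMr// mulrC -ltr_pdivlMr//.
exact: lt_le_trans cw (P_DIST_size_sqr_le k Pmw).
Qed.

Lemma closure_P_DIST u : closure (P_DIST R) u -> u = (fun=> 0) \/ P_DIST R u.
Proof.
move=> Pu; have [->|u0] := pselect (u = (fun=> 0)); [by left|right].
have [k uk] : exists k, u k != 0.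
  apply: contra_notP u0 => /forallNP u0; apply/funext => k.
  by apply: contrapT => /eqP; exact: u0.
have uk2 : 0 < u k ^+ 2 by rewrite lt_neqAle sqr_ge0 eq_sym expf_neq0.
pose c := u k ^+ 2 / 2; have c0 : 0 < c by rewrite divr_gt0.
have [||m _ Pm] := @closure_P_DIST_size u k c (Num.bound (48 / c)) Pu c0.
- by rewrite ltr_pdivrMr// ltr_pMr// ltr1n.
- by apply: archi_boundP; rewrite divr_ge0// ltW.
by rewrite P_DISTE; exists m.
Qed.

Lemma unit_span_one_zeros m : unit_span_multiset (1 :: nseq m.+1 (0 : R)).
Proof.
have size_t : size (1 :: nseq m.+1 (0 : R)) = m.+2 by rewrite /= size_nseq.
split => //; rewrite ?size_t//; last first.
  by rewrite -[LHS]/(nth 0 (nseq m.+1 0) m) nth_nseq if_same.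
by rewrite /= ler01/=; elim: m {size_t} => //= m IH; rewrite lexx.
Qed.

Lemma closure_P_DIST0 : closure (P_DIST R) (fun=> 0 : R).
Proof.
pose t m : seq R := 1 :: nseq m.+1 0.
pose v m : S := hat (distance_multiset (t m)).
have v_coord k : v m k @[m --> \oo] --> (0 : R).
  apply/cvgrPdist_le => e e0; near=> m.
  rewrite sub0r normrN -(ler_pXn2r (n := 2))// ?nnegrE ?(ltW e0)//.
  rewrite -normrX ger0_norm ?sqr_ge0//.
  apply: (le_trans (hat_distance_sqr_le k (unit_span_one_zeros m))).
  rewrite /= size_nseq ler_pdivrMr ?ltr0n// mulrC -ler_pdivrMr ?exprn_gt0//.
  apply: (@le_trans _ _ m%:R); last by rewrite ler_nat -addn2 leq_addr.
  by near: m; exact: nbhs_infty_ger.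
have v_cvg : v @ \oo --> ((fun=> 0) : S).
  by apply/(@pointwise_cvgP nat R (v @ \oo) _ _) => k; exact: v_coord.
move=> B /v_cvg [m _ Bm]; exists (v m); split; last exact: (Bm m (leqnn m)).
by exists (t m) => //; exact: unit_span_one_zeros.
Unshelve. all: by end_near. Qed.

Lemma closure_P_DIST_compact : compact (closure (P_DIST R)).
Proof.
apply: (subclosed_compact _ (@cube_compact R (- 7) 7)); first exact: closed_closure.
rewrite [X in _ `<=` X](closure_id _).1; last exact: closed_cube.
apply: closureS => _ [t ut <-] k /=; rewrite in_itv/= -ler_norml.
rewrite -(ler_pXn2r (n := 2))// ?nnegrE// -normrX ger0_norm ?sqr_ge0//.
apply: (le_trans (hat_distance_sqr_le k ut)).
have t1 : 1 <= (size t)%:R :> R by rewrite ler1n unit_span_size_gt0.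
by rewrite ler_pdivrMr ?(lt_le_trans _ t1)//; lra.
Qed.

End closure_P_DIST.

Section sinhc_products.
Context (R : realType).
Implicit Types (s t : seq R) (l x y a b c : R).

Definition exp_gap l x : R := 1 - expR (- (l * x)).

(* [sinh (l * x / 2) / (l * x / 2)], with the leading exponential factored out. *)
Definition sinhc l x : R := expR (l * x / 2) * exp_gap l x / (l * x).

Definition exp_gap_prod s l : R := \prod_(x <- s) exp_gap l x.

Lemma exp_gap_itv l x : 0 < l -> 0 < x -> 0 < exp_gap l x < 1.
Proof.
move=> l0 x0; rewrite /exp_gap subr_gt0 expR_lt1 oppr_lt0 mulr_gt0//=.
by rewrite ltrBlDr ltrDl expR_gt0.
Qed.

Lemma exp_gap_prod_itv s l : 0 < l -> all (<%R 0) s -> 0 < exp_gap_prod s l <= 1.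
Proof.
move=> l0; rewrite /exp_gap_prod; elim: s => [_|x s IH].
  by rewrite big_nil ltr01 lexx.
move=> /= /andP[x0 /IH/andP[s0 s1]].
rewrite big_cons; have /andP[gap0 /ltW gap1] := exp_gap_itv l0 x0.
by rewrite mulr_gt0//= mulr_ile1// ltW.
Qed.

Lemma exp_gap_prod_cons_le x s l : 0 < l -> 0 < x -> all (<%R 0) s ->
  exp_gap_prod (x :: s) l <= exp_gap l x.
Proof.
move=> l0 x0 /(exp_gap_prod_itv l0)/andP[_ s1].
have /andP[gap0 _] := exp_gap_itv l0 x0.
by rewrite /exp_gap_prod big_cons ler_piMr// ltW.
Qed.

Lemma exp_gap_prod_ge s l y : 0 < l -> all (<%R 0) s -> all (>= y) s ->
  1 - (size s)%:R * expR (- (l * y)) <= exp_gap_prod s l.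
Proof.
move=> l0; elim: s => [_ _|x s IH /= /andP[x0 s0] /andP[yx ys]].
  by rewrite /exp_gap_prod big_nil mul0r subr0.
have /andP[prod0 prod1] := exp_gap_prod_itv l0 s0; have {}IH := IH s0 ys.
have exp_le : expR (- (l * x)) <= expR (- (l * y)).
  by rewrite ler_expR lerN2 ler_pM2l.
have : expR (- (l * x)) * exp_gap_prod s l <= expR (- (l * x)).
  by rewrite ler_piMr// expR_ge0.
rewrite /exp_gap_prod big_cons -/(exp_gap_prod s l) /exp_gap -natr1 mulrBl mulrDl.
by rewrite !mul1r; lra.
Qed.

Lemma exp_gap_prod_cvg1 s : all (<%R 0) s ->
  exp_gap_prod s l @[l --> +oo] --> (1 : R).
Proof.
rewrite /exp_gap_prod; elim: s => [_|x s IH /= /andP[x0 /IH s1]].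
  by under eq_fun do rewrite big_nil; exact: cvg_cst.
rewrite -[X in _ --> X]mulr1; under eq_fun do rewrite big_cons.
apply: cvgM; last exact: s1.
rewrite -[X in _ --> X]subr0; apply: cvgB; first exact: cvg_cst.
apply: (cvg_comp (fun l => l * x) (fun l => expR (- l))); last exact: cvgr_expR.
by apply: gt0_cvgMly => //; exact: cvg_id.
Qed.

Lemma expR_mul_unbounded c (K : R) : 0 < c -> exists2 l, 0 < l & K < expR (l * c).
Proof.
move=> c0; exists ((`|K| + 1) / c); first by rewrite divr_gt0// ltr_wpDl.
rewrite divfK ?gt_eqF//; apply: lt_le_trans (expR_ge1Dx _).
by have := ler_norm K; lra.
Qed.

(* As [l] grows, [1 - exp_gap_prod s l] is of the order of [expR (- (l * x))],
   where [x] is the smallest element of [s]. *)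
Lemma exp_gap_prod_head_le x s y t : all (<%R 0) (x :: s) ->
  all (<%R 0) (y :: t) -> all (>= y) (y :: t) ->
  (forall l, 0 < l -> exp_gap_prod (x :: s) l = exp_gap_prod (y :: t) l) -> y <= x.
Proof.
move=> xs0 yt0 yt_ge eq_prod; have /= /andP[x0 s0] := xs0.
rewrite leNgt; apply/negP => xy.
have yx0 : 0 < y - x by rewrite subr_gt0.
have [l l0] := expR_mul_unbounded (size (y :: t))%:R yx0; set n := (size _)%:R.
apply/negP; rewrite -leNgt.
have := exp_gap_prod_ge l0 yt0 yt_ge; rewrite -/n -eq_prod//.
move=> /le_trans/(_ (exp_gap_prod_cons_le l0 x0 s0)).
rewrite /exp_gap lerD2l lerN2 -(ler_pM2r (expR_gt0 (l * y))) -mulrA -!expRD.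
by rewrite addNr expR0 mulr1 mulrBr addrC.
Qed.

Lemma sorted_cons_all_ge x s : sorted <=%R (x :: s) -> all (>= x) (x :: s).
Proof. by move=> /= xs; rewrite lexx (order_path_min le_trans xs). Qed.

Lemma exp_gap_prod_inj s t : sorted <=%R s -> sorted <=%R t ->
  all (<%R 0) s -> all (<%R 0) t ->
  (forall l, 0 < l -> exp_gap_prod s l = exp_gap_prod t l) -> s = t.
Proof.
have nil_neq x u : all (<%R 0) (x :: u) ->
    ~ (forall l, 0 < l -> exp_gap_prod [::] l = exp_gap_prod (x :: u) l).
  move=> /= /andP[x0 u0] /(_ 1 ltr01) eq_prod.
  have := exp_gap_prod_cons_le ltr01 x0 u0; rewrite -eq_prod /exp_gap_prod big_nil.
  by have /andP[_ gap1] := exp_gap_itv ltr01 x0; rewrite leNgt gap1.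
elim: s t => [|x s IH] [|y t] // s_sorted t_sorted s0 t0 eq_prod.
- by have := nil_neq _ _ t0 eq_prod.
- by exfalso; apply: (nil_neq _ _ s0) => l l0; rewrite eq_prod.
have xy : x = y.
  apply/eqP; rewrite eq_le; apply/andP; split.
    apply: (exp_gap_prod_head_le t0 s0 (sorted_cons_all_ge s_sorted)) => l l0.
    by rewrite eq_prod.
  exact: (exp_gap_prod_head_le s0 t0 (sorted_cons_all_ge t_sorted)).
move: s0 t0 eq_prod => /= /andP[x0 s0] /andP[y0 t0] eq_prod.
congr (_ :: _) => //; apply: IH => //.
- exact: path_sorted s_sorted.
- exact: path_sorted t_sorted.
move=> l l0; have := eq_prod l l0; rewrite /exp_gap_prod !big_cons -xy.
by apply: mulfI; have /andP[gap0 _] := exp_gap_itv l0 x0; rewrite gt_eqF.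
Qed.

Lemma sinhc_gt0 l x : 0 < l -> 0 < x -> 0 < sinhc l x.
Proof.
move=> l0 x0; have /andP[gap0 _] := exp_gap_itv l0 x0.
by rewrite divr_gt0 ?mulr_gt0 ?expR_gt0.
Qed.

Lemma prod_sinhc_gt0 l s : 0 < l -> all (<%R 0) s -> 0 < \prod_(x <- s) sinhc l x.
Proof.
move=> l0 /allP s0; rewrite big_seq; apply: prodr_gt0 => x /s0 x0.
exact: sinhc_gt0.
Qed.

Lemma ln_sinhc l x : 0 < l -> 0 < x ->
  ln (sinhc l x) = l * (x / 2) + ln (exp_gap l x) - ln l - ln x.
Proof.
move=> l0 x0; have /andP[gap0 _] := exp_gap_itv l0 x0.
rewrite /sinhc ln_div ?posrE ?mulr_gt0 ?expR_gt0// !lnM ?posrE ?expR_gt0//.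
by rewrite expRK opprD addrA mulrA.
Qed.

Lemma ln_prod_sinhc l s : 0 < l -> all (<%R 0) s ->
  ln (\prod_(x <- s) sinhc l x) =
  l * (\sum_(x <- s) x / 2) + ln (exp_gap_prod s l) - (size s)%:R * ln l
    - \sum_(x <- s) ln x.
Proof.
move=> l0; rewrite /exp_gap_prod; elim: s => [_|x s IH /= /andP[x0 s0]].
  by rewrite !big_nil mulr0 mul0r ln1 !subr0 addr0.
have /andP[gap0 _] := exp_gap_itv l0 x0.
have /andP[prod0 _] := exp_gap_prod_itv l0 s0.
rewrite !big_cons lnM ?posrE ?sinhc_gt0 ?prod_sinhc_gt0//.
rewrite (@lnM _ (exp_gap l x)) ?posrE// IH// ln_sinhc//=.
by rewrite -natr1; ring.
Qed.

Lemma cst_cvgy_eq a b : (fun _ : R => a) l @[l --> +oo] --> b -> a = b.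
Proof.
have := @cvg_unique _ _ ((fun _ : R => a) @ +oo) _ a b (cvg_cst a).
by apply; exact: norm_hausdorff.
Qed.

Lemma affine_ln_cvg0 a b c : a + b * ln l + c * l @[l --> +oo] --> (0 : R) ->
  [/\ a = 0, b = 0 & c = 0].
Proof.
pose f l := a + b * ln l + c * l => f_cvg0.
pose g l := b * ln 2 + c * l.
have g_cvg0 : g l @[l --> +oo] --> (0 : R).
  have f2_cvg0 : f (2 * l) @[l --> +oo] --> (0 : R).
    apply: (cvg_comp (fun l => 2 * l) f) f_cvg0.
    by apply: gt0_cvgMry => //; exact: cvg_id.
  rewrite -[X in _ --> X](subr0 0); apply: cvg_trans (cvgB f2_cvg0 f_cvg0).
  apply: near_eq_cvg; near=> l; have l0 : 0 < l by near: l; exact: nbhs_pinfty_gt.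
  by rewrite !fctE /f /g lnM ?posrE//; ring.
have c0 : c = 0.
  apply: cst_cvgy_eq; rewrite -[X in _ --> X](subr0 0).
  have g1_cvg0 : g (l + 1) @[l --> +oo] --> (0 : R).
    by apply: (cvg_comp (fun l => l + 1) g) g_cvg0; exact: cvg_addrr.
  apply: cvg_trans (cvgB g1_cvg0 g_cvg0); apply: near_eq_cvg; near=> l.
  by rewrite !fctE /g; ring.
have b0 : b = 0.
  have : b * ln 2 = 0.
    apply: cst_cvgy_eq; move: g_cvg0; rewrite /g c0.
    by under eq_fun do rewrite mul0r addr0.
  by move=> /eqP; rewrite mulf_eq0 ln_eq0// pnatr_eq1 orbF => /eqP.
split=> //; apply: cst_cvgy_eq; move: f_cvg0; rewrite b0 c0.
by under eq_fun do rewrite !mul0r !addr0.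
Unshelve. all: by end_near. Qed.

Lemma prod_sinhc_inj s t : sorted <=%R s -> sorted <=%R t ->
  all (<%R 0) s -> all (<%R 0) t ->
  (forall l, 0 < l -> \prod_(x <- s) sinhc l x = \prod_(x <- t) sinhc l x) ->
  s = t.
Proof.
move=> s_sorted t_sorted s0 t0 eq_prod; apply: exp_gap_prod_inj => // l l0.
pose a := \sum_(x <- s) ln x - \sum_(x <- t) ln x.
pose b : R := (size s)%:R - (size t)%:R.
pose c := \sum_(x <- t) x / 2 - \sum_(x <- s) x / 2.
have ln_ratio (k : R) : 0 < k ->
    ln (exp_gap_prod s k) - ln (exp_gap_prod t k) = a + b * ln k + c * k.
  move=> k0; have := congr1 (@ln R) (eq_prod k k0); rewrite !ln_prod_sinhc//.
  by rewrite /a /b /c; lra.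
have ln_prod_cvg0 (u : seq R) : all (<%R 0) u ->
    ln (exp_gap_prod u k) @[k --> +oo] --> (0 : R).
  move=> /exp_gap_prod_cvg1 u1; rewrite -ln1.
  by apply: (cvg_comp _ (@ln R)) u1 _; exact: continuous_ln.
have [a0 b0 c0] : [/\ a = 0, b = 0 & c = 0].
  apply: affine_ln_cvg0; rewrite -[X in _ --> X](subr0 0).
  apply: cvg_trans (cvgB (ln_prod_cvg0 s s0) (ln_prod_cvg0 t t0)).
  apply: near_eq_cvg; near=> k; have k0 : 0 < k by near: k; exact: nbhs_pinfty_gt.
  by rewrite !fctE ln_ratio.
have /andP[s_gt0 _] := exp_gap_prod_itv l0 s0.
have /andP[t_gt0 _] := exp_gap_prod_itv l0 t0.
have := ln_ratio l l0; rewrite a0 b0 c0 !mul0r !addr0 => /eqP; rewrite subr_eq0.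
by move=> /eqP; apply: ln_inj; rewrite posrE.
Unshelve. all: by end_near. Qed.

End sinhc_products.

Section laplace_transforms.
Context (R : realType).
Local Notation mR := (measurableTypeR R).
Implicit Types (s : seq R) (u v : nat -> R) (l x : R) (n m : nat).

Lemma ge0_measurable_expR l : ge0_measurable (fun x => (expR (l * x))%:E).
Proof.
apply: ge0_measurable_EFin => [|x]; last exact: expR_ge0.
apply: (measurableT_comp (@measurable_expR R)).
exact: mulrl_measurable.
Qed.

Lemma is_derive_expR_scale l x :
  is_derive x 1 (fun y : R => expR (l * y)) (expR (l * x) * l).
Proof.
have scaleD : is_derive x 1 (fun y : R => l * y) l.
  by apply: is_derive_eq; rewrite /GRing.scale/=; ring.
exact: (@is_derive1_comp _ expR (fun y : R => l * y) x _ _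
  (is_derive_expR _) scaleD).
Qed.

Lemma integral_centered_uniform_expR l x : 0 < l -> 0 < x ->
  (\int[centered_uniform x]_y (expR (l * y))%:E = (sinhc l x)%:E)%E.
Proof.
move=> l0 x0; have antiderivative (y : R) :
    is_derive y 1 (fun y : R => expR (l * y) / l) (expR (l * y)).
  apply: (is_derive_eq
    (is_deriveM (is_derive_expR_scale l y) (is_derive_cst l^-1 y 1))).
  by rewrite scaler0 add0r /GRing.scale/=; field; rewrite gt_eqF.
rewrite (integral_centered_uniform_is_derive x0 antiderivative).
  congr EFin; rewrite /sinhc /exp_gap.
  rewrite (_ : l * - (x / 2) = l * x / 2 - l * x); last by field.
  by rewrite expRD mulrA; field; rewrite !gt_eqF.
exact: (@is_derive_continuous _ _ _ (is_derive_expR_scale l)).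
Qed.

Lemma averages_uniform_expR l s : 0 < l -> all (<%R 0) s ->
  averages [seq centered_uniform x | x <- s] (fun x => (expR (l * x))%:E) =
  (fun x => (expR (l * x) * \prod_(y <- s) sinhc l y)%:E).
Proof.
move=> l0; elim: s => [_|y s IH /= /andP[y0 s0]].
  by apply/funext => x /=; rewrite big_nil mulr1.
rewrite -/(averages _ _) IH//; apply/funext => x; rewrite /average big_cons.
have := ltW (prod_sinhc_gt0 l0 s0); set p := \prod_(_ <- s) _ => p0.
transitivity (\int[centered_uniform y]_z
    ((expR (l * x) * p)%:E * (expR (l * z))%:E))%E.
  apply: eq_integral => z _; rewrite -EFinM; congr EFin.
  by rewrite mulrDr expRD; ring.
have [mexp exp0] := ge0_measurable_expR l.
rewrite ge0_integralZl// ?lee_fin ?mulr_ge0 ?expR_ge0//.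
by rewrite integral_centered_uniform_expR// -EFinM; congr EFin; ring.
Qed.

Lemma all_gt0_mkseq u n : positive_multiset n u -> all (<%R 0) (mkseq u n).
Proof.
move=> [_ u_gt0 _]; apply/allP => _ /mapP[k + ->].
by rewrite mem_iota => /andP[_]; exact: u_gt0.
Qed.

Lemma laplace_uniform_sum_law u n l : positive_multiset n u -> 0 < l ->
  (\int[uniform_sum_law u]_x (expR (l * x))%:E =
   (\prod_(x <- mkseq u n) sinhc l x)%:E)%E.
Proof.
move=> un l0; have [u0 _ _] := un.
rewrite (integral_uniform_sum_law_averages u0); last exact: ge0_measurable_expR.
rewrite averages_uniform_expR ?all_gt0_mkseq//.
by rewrite mulr0 expR0 mul1r.
Qed.

Lemma sorted_rev_mkseq u n : (forall i j, (i <= j)%N -> u j <= u i) ->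
  sorted <=%R (rev (mkseq u n)).
Proof.
move=> u_dec; rewrite rev_sorted; apply/(sortedP 0) => i; rewrite size_mkseq => ik.
by rewrite !nth_mkseq ?u_dec//; exact: ltnW.
Qed.

Lemma uniform_sum_law_inj u v n m :
  positive_multiset n u -> positive_multiset m v ->
  uniform_sum_law u = uniform_sum_law v -> u = v.
Proof.
move=> un vm uv; have [u0 _ u_dec] := un; have [v0 _ v_dec] := vm.
have rev_eq : rev (mkseq u n) = rev (mkseq v m).
  apply: prod_sinhc_inj;
    rewrite ?sorted_rev_mkseq ?all_rev ?all_gt0_mkseq// => l l0.
  have perm_prod s : \prod_(x <- rev s) sinhc l x = \prod_(x <- s) sinhc l x.
    by apply: perm_big; rewrite perm_rev.
  by apply: EFin_inj; rewrite !perm_prod -!laplace_uniform_sum_law// uv.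
have mkseq_eq : mkseq u n = mkseq v m by exact: (can_inj revK).
have nm : n = m by have := congr1 size mkseq_eq; rewrite !size_mkseq.
apply/funext => k; have [nk|kn] := leqP n k; first by rewrite u0// v0// -nm.
by have := congr1 (nth 0 ^~ k) mkseq_eq; rewrite !nth_mkseq// -nm.
Qed.

End laplace_transforms.

Section tails.
Context (R : realType).
Local Notation leb := (@lebesgue_measure R).
Implicit Types (s : seq R) (u : nat -> R).
Local Open Scope ereal_scope.

Lemma averages_uniform_support s (f : R -> \bar R) (b : R) : all (<%R 0%R) s ->
  ge0_measurable f -> (forall x, (x <= b)%R -> f x = 0) ->
  forall x, (x <= b - \sum_(y <- s) y)%R ->
  averages [seq centered_uniform y | y <- s] f x = 0.
Proof.
move=> + gmf fb; elim: s => [_ x|y s IH /= /andP[y0 s0] x].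
  by rewrite big_nil subr0 => /fb.
rewrite big_cons -/(averages _ _) => xb; apply/eqP; rewrite eq_le.
have gms := ge0_measurable_averages [seq centered_uniform z | z <- s] gmf.
have [_ ->] := ge0_measurable_average (centered_uniform y) gms; rewrite andbT.
apply: (ge0_integral_centered_uniform_le y0 (ge0_measurable_shift x gms)) => z.
rewrite ler_norml => /andP[_ zy]; rewrite IH//.
by move: xb y0 zy; clear; lra.
Qed.

Lemma uniform_sum_law_tail u n : positive_multiset n u ->
  uniform_sum_law u `](\sum_(x <- mkseq u n) x)%R, +oo[%classic = 0.
Proof.
move=> un; have [u0 _ _] := un; set b := (\sum_(x <- _) x)%R.
have gm_tail := ge0_measurable_indic (measurable_itv `]b, +oo[).
rewrite -integral_indicT// (integral_uniform_sum_law_averages u0 gm_tail).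
apply: (averages_uniform_support (b := b) (all_gt0_mkseq un) gm_tail).
  move=> x xb; rewrite /= indicE memNset//= in_itv/= andbT.
  by apply/negP; rewrite -leNgt.
by rewrite subrr.
Qed.

Lemma normal_prob_gt0 (m s : R) (A : set (measurableTypeR R)) : s != 0%R ->
  measurable A -> 0 < leb A -> 0 < normal_prob m s A.
Proof.
move=> s0 mA A0; rewrite lt0e measure_ge0 andbT; apply/negP => /eqP NA0.
have mpdf : measurable_fun A (EFin \o normal_pdf m s).
  by apply: measurable_funTS; apply/measurable_EFinP; exact: measurable_normal_pdf.
have : ae_eq leb A (EFin \o normal_pdf m s) (cst 0).
  apply/ae_eq_integral_abs => //; rewrite -[RHS]NA0; apply: eq_integral => x _.
  by rewrite /= ger0_norm// normal_pdf_ge0.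
have pdf_gt0 x : (0 < normal_pdf m s x)%R.
  by rewrite normal_pdfE// mulr_gt0 ?normal_peak_gt0 ?expR_gt0.
move=> [N [mN N0 subN]]; have : leb A <= leb N.
  apply: le_measure; rewrite ?inE// => x Ax; apply: subN => /= /(_ Ax) [pdf0].
  by have := pdf_gt0 x; rewrite pdf0 ltxx.
by rewrite leNgt N0 A0.
Qed.

Lemma uniform_sum_law_neq_normal u n : positive_multiset n u ->
  uniform_sum_law u <> std_normal R.
Proof.
move=> un uN; have := uniform_sum_law_tail un; rewrite uN law_ofE//.
apply/eqP; rewrite gt_eqF//; apply: normal_prob_gt0 => //.
by rewrite lebesgue_measure_itv/= ltry ltry.
Qed.

End tails.

Section compact_spaces.
Implicit Types X Y : topologicalType.

Lemma compact_hausdorff_homeomorphism X Y (K : set X) (f : X -> Y) :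
  hausdorff_space Y -> compact K -> K !=set0 -> {within K, continuous f} ->
  set_inj K f -> homeomorphism_on K (f @` K) f.
Proof.
move=> Y_hausdorff K_compact [x0 _] f_continuous f_inj.
pose g := 'pinv_(fun=> x0) K f.
have gK x : K x -> g (f x) = x by move=> Kx; apply: pinvKV; rewrite ?inE.
split=> //; first by split => //; exact: subset_refl.
exists g => //; apply/continuous_closedP => C C_closed.
apply/closed_subspaceP; exists (f @` (K `&` C)).
  apply: compact_closed => //; apply: continuous_compact.
    by apply: continuous_subspaceW f_continuous => x [].
  exact: compact_closedI.
apply/seteqP; split=> y [Cy [x Kx fxy]]; split; try by exists x.
  by case: Cy => z [Kz Cz] <-; rewrite /from_subspace/= gK.
by exists x => //; move: Cy; rewrite /from_subspace/= -fxy gK.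
Qed.

Lemma closure_image_compact X Y (A : set X) (f : X -> Y) :
  hausdorff_space Y -> compact (closure A) -> {within closure A, continuous f} ->
  closure (f @` A) = f @` closure A.
Proof.
move=> Y_hausdorff A_compact f_continuous; apply/seteqP; split.
  have /closure_id -> : closed (f @` closure A).
    by apply: compact_closed => //; exact: continuous_compact.
  by apply: closureS; apply: image_subset; exact: subset_closure.
move=> _ [x clAx <-] B fxB.
have /subspace_continuousP/(_ x clAx)/(_ _ fxB) near_fB := f_continuous.
have [y [Ay By]] := clAx _ near_fB.
by exists (f y); split; [exists y|apply: By; exact: subset_closure].
Qed.

Lemma homeomorphism_on_seq_compact X Y (K : set X) (B : set Y) (f : X -> Y) :
  homeomorphism_on K B f -> seq_compact B -> seq_compact K.
Proof.
move=> [[fKB _ fB] _ [g gK /subspace_continuousP g_continuous]] B_compact u uK.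
have [n|phi phi_incr [l Bl fu_cvg]] := B_compact (f \o u); first exact: fKB.
exists phi => //; exists (g l); first by have [x Kx <-] := fB _ Bl; rewrite gK.
move=> A nbhsA; have near_gA : \forall n \near \oo, B (f (u (phi n))) ->
    A (g (f (u (phi n)))) by exact: fu_cvg _ (g_continuous _ Bl _ nbhsA).
suff : \forall n \near \oo, A (u (phi n)) by [].
by apply: filterS near_gA => n; rewrite gK//; apply; exact: fKB.
Qed.

Lemma metric_seq_compact (R : realType) (V : metricType R) (A : set V) :
  compact A -> seq_compact A.
Proof.
move=> A_compact u uA.
have [|l [Al ul]] := A_compact (u @ \oo) _.
  by exists 0%N => // n _; exact: uA.
have dist_cluster : cluster ((fun n => mdist l (u n)) @ \oo) (0 : R).
  apply/cluster_eventuallyP => e n e0.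
  have [||_ [[m nm <-] lm]] := ul (u @` [set m | (n <= m)%N]) (ball l e).
  - by exists n => // m nm; exists m.
  - exact: nbhsx_ballx.
  exists m => //; rewrite sub0r normrN ger0_norm ?mdist_ge0// ltW//.
  by move: lm; rewrite ballEmdist.
have [phi phi_incr /cvgrPdist_lt dist_cvg0] :=
  (cluster_eventually_cvg _ _).1 dist_cluster.
exists phi; first by move=> m n; rewrite (leqW_mono phi_incr).
exists l => //; apply/cvg_ballP => e /dist_cvg0[N _ near_l]; exists N => // n Nn.
have := near_l n Nn; rewrite ballEmdist/= sub0r normrN.
by rewrite ger0_norm ?mdist_ge0.
Qed.

End compact_spaces.

Section levy_bounds.
Context (R : realType).
Implicit Types (u v : nat -> R) (e : R).

Lemma levy_std_normal_lt e : 0 < e -> exists2 c : R, 0 < c &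
  forall u n, positive_multiset n u -> \sum_(0 <= k < n) u k ^+ 2 = 12 ->
  u 0%N <= c -> levy_dist (std_normal R) (uniform_sum_law u) < e.
Proof.
move=> e0; have [h [d [h0 d0 levy_lt]]] := levy_dist_lt_step e0.
exists (d * h ^+ 3 / 130); first by rewrite divr_gt0 ?mulr_gt0 ?exprn_gt0.
move=> u n [un u_gt0 u_dec] u12 u0c.
have u_itv x : x \in mkseq u n -> 0 < x <= d * h ^+ 3 / 130.
  move=> /mapP[k]; rewrite mem_iota => /andP[_ kn] ->.
  by rewrite u_gt0//= (le_trans _ u0c)// u_dec.
have sumsq : \sum_(x <- mkseq u n) x ^+ 2 = 12.
  by rewrite big_map -u12 /index_iota subn0.
have errorE : 130 * (d * h ^+ 3 / 130) / h ^+ 3 = d.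
  by field; rewrite gt_eqF.
apply: levy_lt => a; have := lindeberg_uniform a h0 u_itv sumsq; rewrite errorE /=;
  by rewrite (integral_uniform_sum_law_averages un (ge0_measurable_step a h)); case.
Qed.

Lemma levy_uniform_sum_lt e : 0 < e -> exists2 d : R, 0 < d &
  forall u v n, vanishes_from n u -> vanishes_from n v ->
  (forall k, 0 <= u k) -> (forall k, 0 <= v k) ->
  \sum_(0 <= k < n) `|u k - v k| <= d ->
  levy_dist (uniform_sum_law u) (uniform_sum_law v) < e.
Proof.
move=> e0; have [h [d [h0 d0 levy_lt]]] := levy_dist_lt_step e0.
exists (d * h); first by rewrite mulr_gt0.
have integral_le u v n a : vanishes_from n u -> vanishes_from n v ->
    (forall k, 0 <= u k) -> (forall k, 0 <= v k) ->
    \sum_(0 <= k < n) `|u k - v k| <= d * h ->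
    (\int[uniform_sum_law u]_x (step a h x)%:E <=
     \int[uniform_sum_law v]_x (step a h x)%:E + d%:E)%E.
  move=> un vn u0 v0 uv; have gm := ge0_measurable_step a h.
  rewrite (integral_uniform_sum_law_averages un gm).
  rewrite (integral_uniform_sum_law_averages vn gm) -!map_comp.
  have hV0 : 0 <= h^-1 by rewrite invr_ge0 ltW.
  have lip y z : step a h y <= step a h z + h^-1 * `|y - z|.
    by rewrite mulrC; exact: step_lipschitz.
  apply: (le_trans (le_averages_sum (c := fun k => h^-1 * `|u k - v k|) gm _ _ _)).
  - by move=> k _; rewrite mulr_ge0.
  - by move=> k x _; exact: average_centered_uniform_lipschitz.
  rewrite leeD2l// lee_fin -mulr_sumr ler_pdivrMl// mulrC.
  by rewrite /index_iota subn0 in uv.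
move=> u v n un vn u0 v0 uv; apply: levy_lt => a; apply: (integral_le _ _ n) => //.
by under eq_bigr do rewrite distrC.
Qed.

End levy_bounds.

Section Phi_DIST.
Context (R : realType).
Local Notation S := {ptws nat -> R}.
Implicit Types (u v : S) (e : R).

Lemma Phi_DIST0 : Phi_DIST (fun=> 0 : R) = std_normal R.
Proof. by rewrite /Phi_DIST asboolT. Qed.

Lemma Phi_DISTE u : P_DIST R u -> Phi_DIST u = uniform_sum_law u.
Proof. by move=> /P_DIST_neq0 u0; rewrite /Phi_DIST asboolF. Qed.

Lemma image_Phi_DIST : @Phi_DIST R @` P_DIST R = M_DIST R.
Proof.
rewrite image_comp; apply: eq_imagel => t ut.
by apply: Phi_DISTE; exists t.
Qed.

Lemma image_Phi_DIST_closure :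
  @Phi_DIST R @` closure (P_DIST R) = M_DIST R `|` [set std_normal R].
Proof.
have -> : closure (P_DIST R) = P_DIST R `|` [set fun=> 0].
  apply/seteqP; split => u.
    by move=> /closure_P_DIST[->|Pu]; [right|left].
  by move=> [|->]; [exact: subset_closure|exact: closure_P_DIST0].
by rewrite image_setU image_Phi_DIST image_set1 Phi_DIST0.
Qed.

Section near_limit.
Variables (F : set_system S) (u : S).
Context {FF : Filter F}.
Hypothesis F_cvg : F --> u.

Lemma near_coord k e : 0 < e -> \forall v \near F, `|u k - v k| < e.
Proof.
move=> e0; apply: F_cvg.
by apply: (@coord_continuous R k u [set y | `|u k - y| < e]); exact: nbhsx_ballx.
Qed.

Lemma near_coord_sum n e : 0 < e ->
  \forall v \near F, \sum_(0 <= k < n) `|u k - v k| < e.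
Proof.
elim: n e => [e e0|n IH e e0]; first by apply: nearW => v; rewrite big_geq.
have e20 : 0 < e / 2 by rewrite divr_gt0.
apply: filterS2 (IH _ e20) (near_coord n e20) => v sum_lt coord_lt.
by rewrite big_nat_recr//= [ltRHS]splitr ltrD.
Qed.

Lemma near_levy_std_normal e : u = (fun=> 0) -> 0 < e -> \forall v \near F,
  P_DIST R v -> levy_dist (std_normal R) (uniform_sum_law v) < e.
Proof.
move=> u0 /levy_std_normal_lt[c c0 levy_lt].
apply: filterS (near_coord 0 c0) => v v0c /P_DIST_positive_multiset[n vn v12].
apply: (levy_lt _ n) => //; apply: le_trans (ltW v0c).
by rewrite u0 sub0r normrN ler_norm.
Qed.

Lemma near_P_DIST_size : P_DIST R u -> exists N, \forall v \near F,
  closure (P_DIST R) v -> exists2 m, (m < N)%N & P_DIST_size m v.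
Proof.
move=> /P_DIST_gt0 u0; have half0 : 0 < u 0%N / 2 by rewrite divr_gt0.
have c0 : 0 < (u 0%N / 2) ^+ 2 by rewrite exprn_gt0.
exists (Num.bound (48 / (u 0%N / 2) ^+ 2)).
apply: filterS (near_coord 0 half0) => v uv0 Pv.
apply: (closure_P_DIST_size (k := 0) Pv c0); last first.
  by apply: archi_boundP; rewrite divr_ge0// ltW.
have v0 : u 0%N / 2 < v 0%N by move: uv0; rewrite ltr_norml => /andP[_]; lra.
by rewrite ltr_pXn2r// nnegrE ltW// (lt_trans half0).
Qed.

Lemma near_levy_uniform_sum e : P_DIST R u -> 0 < e -> \forall v \near F,
  closure (P_DIST R) v ->
  P_DIST R v /\ levy_dist (uniform_sum_law u) (uniform_sum_law v) < e.
Proof.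
move=> Pu /levy_uniform_sum_lt[d d0 levy_lt].
have [N near_size] := near_P_DIST_size Pu.
have [n [un u0 _ _]] : exists n, normalized n u.
  move: Pu; rewrite P_DISTE => -[m _ /P_DIST_size_normalized u_norm].
  by exists (size (index_pairs m)).
have near_sum : \forall v \near F, forall m, m \in iota 0 N ->
    \sum_(0 <= k < n + size (index_pairs m)) `|u k - v k| < d.
  by apply: near_all_in => m _; exact: near_coord_sum.
apply: filterS2 near_size near_sum => v v_size uv /v_size[m mN Pmv].
split; first by rewrite P_DISTE; exists m.
have [vm v0 _ _] := P_DIST_size_normalized Pmv.
apply: (levy_lt _ _ (n + size (index_pairs m))%N) => //.
- by move=> k nk; rewrite un// (leq_trans (leq_addr _ _) nk).
- by move=> k nk; rewrite vm// (leq_trans (leq_addl _ _) nk).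
- by apply/ltW/uv; rewrite mem_iota.
Qed.

Lemma near_levy_Phi_DIST e : closure (P_DIST R) u -> 0 < e -> \forall v \near F,
  closure (P_DIST R) v -> levy_dist (Phi_DIST u) (Phi_DIST v) < e.
Proof.
move=> /closure_P_DIST[u0|Pu] e0.
  apply: filterS (near_levy_std_normal u0 e0) => v levy_lt /closure_P_DIST[->|Pv].
    by rewrite u0 levy_distxx.
  by rewrite u0 Phi_DIST0 Phi_DISTE//; exact: levy_lt.
apply: filterS (near_levy_uniform_sum Pu e0) => v near_v /near_v[Pv levy_lt].
by rewrite !Phi_DISTE.
Qed.

End near_limit.

Lemma Phi_DIST_continuous : {within closure (P_DIST R), continuous (@Phi_DIST R)}.
Proof.
apply/subspace_continuousP => u Pu.
apply/metricType_numDomainType.cvgrPdist_lt => e e0.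
exact: (near_levy_Phi_DIST (F := nbhs u) cvg_id Pu e0).
Qed.

Lemma Phi_DIST_neq_normal u : P_DIST R u -> Phi_DIST u <> std_normal R.
Proof.
move=> Pu; rewrite Phi_DISTE//; have [n un _] := P_DIST_positive_multiset Pu.
exact: uniform_sum_law_neq_normal un.
Qed.

Lemma Phi_DIST_inj : set_inj (closure (P_DIST R)) (@Phi_DIST R).
Proof.
move=> u v /[!inE] /closure_P_DIST[->|Pu] /closure_P_DIST[->|Pv] //.
- by rewrite Phi_DIST0 => /esym /(Phi_DIST_neq_normal Pv).
- by rewrite Phi_DIST0 => /(Phi_DIST_neq_normal Pu).
have [n un _] := P_DIST_positive_multiset Pu.
have [m vm _] := P_DIST_positive_multiset Pv.
by rewrite !Phi_DISTE//; exact: uniform_sum_law_inj un vm.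
Qed.

Lemma M_DIST_std_normal : M_DIST R `&` [set std_normal R] = set0.
Proof.
rewrite -image_Phi_DIST; apply/seteqP; split => // _ [[u Pu <-] /=].
exact: Phi_DIST_neq_normal.
Qed.

Lemma closure_M_DIST : closure (M_DIST R) = @Phi_DIST R @` closure (P_DIST R).
Proof.
rewrite -image_Phi_DIST; apply: closure_image_compact.
- exact: metric_hausdorff.
- exact: closure_P_DIST_compact.
- exact: Phi_DIST_continuous.
Qed.

Lemma closure_M_DIST_compact : compact (closure (M_DIST R)).
Proof.
rewrite closure_M_DIST; apply: continuous_compact; first exact: Phi_DIST_continuous.
exact: closure_P_DIST_compact.
Qed.

Lemma Phi_DIST_homeomorphism :
  homeomorphism_on (closure (P_DIST R)) (closure (M_DIST R)) (@Phi_DIST R).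
Proof.
rewrite closure_M_DIST; apply: compact_hausdorff_homeomorphism.
- exact: metric_hausdorff.
- exact: closure_P_DIST_compact.
- by exists (fun=> 0); exact: closure_P_DIST0.
- exact: Phi_DIST_continuous.
- exact: Phi_DIST_inj.
Qed.

Lemma is_uniform_sum_lawE u : closure (P_DIST R) u -> u <> (fun=> 0) ->
  [set mu | is_uniform_sum_law u mu] = [set uniform_sum_law u].
Proof.
move=> /closure_P_DIST[//|/P_DIST_positive_multiset[n [un _ _] _]] _.
apply/seteqP; split => [mu u_mu|_ ->]; last exact: uniform_sum_lawP un.
exact: uniform_sum_law_uniq un u_mu (uniform_sum_lawP un).
Qed.

End Phi_DIST.

Theorem theorem3p32 (R : realType) :
  [/\ (forall u : {ptws nat -> R}, closure (P_DIST R) u -> u <> (fun=> 0) ->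
         [set mu | is_uniform_sum_law u mu] = [set uniform_sum_law u]),
      closure (M_DIST R) = M_DIST R `|` [set std_normal R],
      M_DIST R `&` [set std_normal R] = set0,
      homeomorphism_on (closure (P_DIST R)) (closure (M_DIST R))
        (@Phi_DIST R) &
      [/\ compact (closure (P_DIST R)), seq_compact (closure (P_DIST R)),
          compact (closure (M_DIST R)) & seq_compact (closure (M_DIST R))]].
Proof.
have M_seq_compact : seq_compact (closure (M_DIST R)).
  exact: metric_seq_compact (@closure_M_DIST_compact R).
split; last split.
- exact: is_uniform_sum_lawE.
- by rewrite closure_M_DIST image_Phi_DIST_closure.
- exact: M_DIST_std_normal.
- exact: Phi_DIST_homeomorphism.
- exact: closure_P_DIST_compact.
- exact: homeomorphism_on_seq_compact (@Phi_DIST_homeomorphism R) M_seq_compact.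
- exact: closure_M_DIST_compact.
- exact: M_seq_compact.
Qed.
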